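(* With all matrices and constants as defined in the context, let $\hat\delta:=(\underline{\nu}_0-\sqrt3\,\sigma_\nu\,\chi)\,\delta$, let $0<a_\delta<1$, and set $a=a_\delta\hat\delta$. Let $$\mathcal{C}=\begin{bmatrix}\mathcal{A}&\mathcal{B}^{\mathrm T}\\ \mathcal{B}&0\end{bmatrix},\qquad \mathcal{P}_2=\begin{bmatrix}a\,\widetilde{\mathcal{A}}_{\mathrm{mg}}&0\\ \mathcal{B}&-\widetilde{\mathcal{S}}_p\end{bmatrix},\qquad \mathcal{H}=\begin{bmatrix}\mathcal{A}-a_\delta\hat\delta\,\widetilde{\mathcal{A}}_{\mathrm{mg}}&0\\ 0&\widetilde{\mathcal{S}}_p\end{bmatrix}.$$ Then $\mathcal{H}$ defines an inner product (i.e. $\mathcal{H}$ is symmetric positive definite). Moreover, $\mathcal{P}_2^{-1}\mathcal{C}$ is $\mathcal{H}$-symmetric and $\mathcal{H}$-positive definite, i.e. $$\mathcal{H}\mathcal{P}_2^{-1}\mathcal{C}=(\mathcal{P}_2^{-1}\mathcal{C})^{\mathrm T}\mathcal{H},$$ $$\boldsymbol w^{\mathrm T}\mathcal{H}\mathcal{P}_2^{-1}\mathcal{C}\,\boldsymbol w>0$$ for all nonzero $\boldsymbol w=(\boldsymbol v,\boldsymbol q)\in\mathbb{R}^{QN_u}\times\mathbb{R}^{QN_p}$ whose pressure part $\boldsymbol q$ is the coefficient vector of a zero-mean pressure, i.e. $(I\otimes\boldsymbol 1^{\mathrm T}M_p)\,\boldsymbol q=\boldsymbol 0$, where $\boldsymbol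 1\in\mathbb{R}^{N_p}$ is the all-ones vector.
   Context: Setting. $D\subset\mathbb{R}^2$ is a bounded domain with sufficiently regular boundary, equipped with a regular triangulation of mesh size $h$. Viscosity data. $\nu_0\in L^\infty(D)$ with $\underline{\nu}_0:=\operatorname{ess\,inf}_{D}\nu_0>0$ and $\overline{\nu}_0:=\operatorname{ess\,sup}_{D}\nu_0<\infty$; $\sigma_\nu>0$ is a real number; for $m\in\mathbb{N}$, $\lambda_m\ge 0$ and $\nu_m$ are such that $\sqrt{\lambda_m}\,\nu_m\in L^\infty(D)$. Put $\chi_m:=\|\sqrt{\lambda_m}\,\nu_m\|_{L^\infty(D)}$ and assume $\chi:=\sum_{m=1}^\infty\chi_m<\infty$. Standing assumption: $\underline{\nu}_0>\sqrt3\,\sigma_\nu\,\chi$. Finite element matrices (Taylor-Hood $P_2/P_1$). Let $\{\phi_i\}_{i=1}^{N_u}$ be the basis of the space $\boldsymbol V_0^h$ of vector-valued continuous piecewise quadratic functions on the triangulation vanishing on $\partial D$, and $\{\varphi_i\}_{i=1}^{N_p}$ the nodal basis of continuous piecewise linear functions. Let $W_0^h$ be the space of continuous piecewise linear functions $q$ with $\int_D q\,dx=0$. Define $(A)_{ij}=\int_D\nabla\phi_i\cdot\nabla\phi_j\,dx$, $(A_0)_{ij}=\int_D\nu_0\,\nabla\phi_i\cdot\nabla\phi_j\,dx$, $(A_m)_{ij}=\int_D\sigma_\nu\sqrt{\lambda_m}\,\nu_m\,\nabla\phi_i\cdot\nabla\phi_j\,dx$ ($m=1,\dots,M$), $(B)_{ij}=-\int_D\varphi_i\,\nabla\cdot\phi_j\,dx$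 ($B\in\mathbb{R}^{N_p\times N_u}$), $(M_p)_{ij}=\int_D\varphi_i\varphi_j\,dx$, and $D_p=\operatorname{diag}(M_p)$, the diagonal part of $M_p$. The elements are inf-sup stable: $\gamma=\inf_{0\ne q\in W_0^h}\sup_{0\ne v\in\boldsymbol V_0^h}\frac{|\int_D q\,\nabla\cdot v\,dx|}{\|\nabla v\|_{L^2(D)}\|q\|_{L^2(D)}}>0$. Multigrid preconditioner. $\widetilde{A}_{\mathrm{mg}}\in\mathbb{R}^{N_u\times N_u}$ (one multigrid V-cycle) is symmetric and spectrally equivalent to $A$: there are constants $\delta,\Delta>0$, independent of $h$, with $\delta\le \frac{\boldsymbol v^{\mathrm T}A\boldsymbol v}{\boldsymbol v^{\mathrm T}\widetilde{A}_{\mathrm{mg}}\boldsymbol v}\le\Delta$ for all $\boldsymbol v\in\mathbb{R}^{N_u}\setminus\{\boldsymbol0\}$; in particular $\widetilde A_{\mathrm{mg}}$ is positive definite. Stochastic Galerkin matrices. Let $\rho$ be the uniform probability measure on $[-\sqrt3,\sqrt3]^M$ and let $\{\psi_i\}_{i=1}^{Q}$, $Q=\binom{M+k}{k}$, be the $\rho$-orthonormal Legendre basis of the space of $M$-variate polynomials of total degree at most $k$. Then $I$ is the $Q\times Q$ identity and $(G_m)_{ij}=\int y_m\,\psi_i(y)\psi_j(y)\,\rho(dy)$ for $m=1,\dots,M$. $\otimes$ denotes the Kronecker product. SGFE matrices. $\mathcal{A}=I\otimes A_0+\sum_{m=1}^{M}G_m\otimes A_m$, $\mathcal{B}=I\otimes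 B$, $\widetilde{\mathcal{A}}_{\mathrm{mg}}=I\otimes\widetilde{A}_{\mathrm{mg}}$, $\widetilde{\mathcal{S}}_p=I\otimes D_p$. *)

(* Defs.v *)
From HB Require Import structures.
From mathcomp Require Import all_boot all_order all_algebra.
From mathcomp Require Import all_classical all_reals all_analysis.
From mathcomp Require Import ess_sup_inf.
From mathcomp.real_closed Require Import mxtens.

Set Implicit Arguments.
Unset Strict Implicit.
Unset Printing Implicit Defensive.

Import Order.TTheory GRing.Theory Num.Theory.
Import numFieldNormedType.Exports.

Local Open Scope classical_set_scope.
Local Open Scope ring_scope.

Section Plane.
Context {R : realType}.
Local Notation pt := (R * R)%type.
Local Notation mpt := (measurableTypeR R * measurableTypeR R)%type.

Lemma open_measurable_plane (U : set pt) : open U -> measurable (U : set mpt).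
Proof.
move=> oU.
pose B (x y : rat) (n : nat) : set pt := ball ((ratr x, ratr y) : pt) n.+1%:R^-1.
have -> : U = \bigcup_x \bigcup_y \bigcup_n
    (if `[< B x y n `<=` U >] then B x y n else set0).
  apply/seteqP; split => [p Up|p [x _ [y _ [n _]]]]; last first.
    by case: ifPn => // /asboolP; apply.
  have /nbhs_ballP[e /= e0 peU] : nbhs p U by exact: open_nbhs_nbhs.
  have e20 : 0 < e / 2 by rewrite divr_gt0.
  pose n := Num.truncn (e / 2)^-1.
  have ne : n.+1%:R^-1 < e / 2 :> R.
    by rewrite invf_plt ?posrE//; exact: truncnS_gt.
  have n0 : 0 < n.+1%:R^-1 :> R by rewrite invr_gt0.
  have dense (z : R) : exists q : rat, ball z n.+1%:R^-1 (ratr q).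
    have [|q] := @rat_in_itvoo R (z - n.+1%:R^-1) (z + n.+1%:R^-1).
      by rewrite ltrD2l gt0_cp.
    rewrite in_itv/= => /andP[zq qz]; exists q.
    by rewrite /ball/= distrC ltr_distl zq qz.
  have [x px] := dense p.1; have [y py] := dense p.2.
  have Bp : B x y n p by split; apply: ball_sym.
  exists x => //; exists y => //; exists n => //.
  rewrite asboolT// => r Br; apply: peU; apply: (@le_ball _ _ _ (n.+1%:R^-1 + n.+1%:R^-1)).
    by rewrite [e]splitr lerD// ltW.
  by apply: (@ball_triangle _ _ ((ratr x, ratr y) : pt)) => //; apply: ball_sym.
apply: bigcupT_measurable_rat => x; apply: bigcupT_measurable_rat => y.
apply: bigcupT_measurable => n; case: ifPn => // _.
rewrite (_ : B x y n = ball (ratr x : R) n.+1%:R^-1 `*` ball (ratr y : R) n.+1%:R^-1) //.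
by apply: measurableX; exact: measurable_realfun.measurable_ball.
Qed.
Arguments open_measurable_plane : clear implicits.

Definition area := (@lebesgue_measure R \x @lebesgue_measure R)%E.

(* Around each boundary point there is an orthonormal frame (u, u^perp) in
   which D is, inside a box, the strict subgraph of a Lipschitz function. *)
Definition lipschitz_boundary (D : set pt) : Prop :=
  forall x0, closure D x0 -> ~ D x0 ->
  exists (u : pt) (r h L : R) (g : R -> R),
    [/\ u.1 ^+ 2 + u.2 ^+ 2 = 1, 0 < r, 0 < h,
        (forall s t, `|g s - g t| <= L * `|s - t|) &
        forall s t, `|s| < r -> `|t| < h ->
          (D (x0 + s *: u + t *: (- u.2, u.1)) <-> t < g s)].

Record domain : Type := Domain {
  dom :> set pt;
  dom_open : open dom;
  dom_nonempty : dom !=set0;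
  dom_connected : connected dom;
  dom_bounded : bounded_set dom;
  dom_lipschitz : lipschitz_boundary dom }.

Arguments dom : clear implicits.
Arguments dom_open : clear implicits.

Section FunctionsOnDomain.
Variable D : domain.

Definition area_on :=
  mrestr area (open_measurable_plane (dom D) (dom_open D)).

Definition ess_inf_on (f : pt -> R) : \bar R := ess_inf area_on (EFin \o f).
Definition ess_sup_on (f : pt -> R) : \bar R := ess_sup area_on (EFin \o f).
Definition Linfty_norm (f : pt -> R) : \bar R := Lnorm area_on +oo (EFin \o f).
Definition Linfty (f : pt -> R) : Prop :=
  measurable_fun (dom D : set mpt) (f : mpt -> R) /\ (Linfty_norm f < +oo)%E.

Definition intD (f : pt -> R) : R := \int[area]_(x in dom D) f x.

End FunctionsOnDomain.

Definition simplex n (a : 'I_n -> pt) (s : {set 'I_n}) : set pt :=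
  [set x | exists c : 'I_n -> R,
     [/\ forall i, i \in s -> 0 <= c i, \sum_(i in s) c i = 1
       & x = \sum_(i in s) c i *: a i]].

Definition affinely_independent n (a : 'I_n -> pt) (s : {set 'I_n}) : Prop :=
  forall c : 'I_n -> R,
    \sum_(i in s) c i = 0 -> \sum_(i in s) c i *: a i = 0 ->
  forall i, i \in s -> c i = 0.

(* Cells are given by their sets of vertex indices.  [tri_conforming] says
   that two triangles meet in a common edge, a common vertex or not at all. *)
Record triangulation (D : domain) : Type := Triangulation {
  nvert : nat;
  vert : 'I_nvert -> pt;
  cells : {set {set 'I_nvert}};
  tri_card : forall s, s \in cells -> #|s| = 3%N;
  tri_nondegenerate : forall s, s \in cells -> affinely_independent vert s;
  tri_vert : forall i, exists2 s, s \in cells & i \in s;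
  tri_conforming : forall s t, s \in cells -> t \in cells ->
    simplex vert s `&` simplex vert t = simplex vert (s :&: t);
  tri_cover : closure (dom D) = \bigcup_(s in [set` cells]) simplex vert s }.

Arguments vert {D} T i : rename.

Definition poly_deg_le (k : nat) (p : pt -> R) : Prop :=
  exists c : nat -> nat -> R, forall x,
    p x = \sum_(i < k.+1) \sum_(j < k.+1 - i) c i j * x.1 ^+ i * x.2 ^+ j.

Section FiniteElements.
Variables (D : domain) (T : triangulation D).

(* Finite element functions are total functions on the plane of which only
   the values on [closure D] matter. *)
Definition cont_pw_poly (k : nat) (f : pt -> R) : Prop :=
  {within closure (dom D), continuous f} /\
  forall s, s \in cells T -> exists2 p, poly_deg_le k p &
    forall x, simplex (vert T) s x -> f x = p x.

Definition V0h (v : pt -> pt) : Prop :=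
  [/\ cont_pw_poly 2 (fun x => (v x).1), cont_pw_poly 2 (fun x => (v x).2) &
      forall x, closure (dom D) x -> ~ dom D x -> v x = 0].

Definition W0h (q : pt -> R) : Prop := cont_pw_poly 1 q /\ intD D q = 0.

Definition V0h_basis n (phi : 'I_n -> pt -> pt) : Prop :=
  (forall i, V0h (phi i)) /\
  forall v, V0h v -> exists! c : 'rV[R]_n,
    forall x, closure (dom D) x -> v x = \sum_i c 0 i *: phi i x.

Definition P1_nodal_basis (vphi : 'I_(nvert T) -> pt -> R) : Prop :=
  forall i, cont_pw_poly 1 (vphi i) /\
    forall j, vphi i (vert T j) = (i == j)%:R.

(* Classical partial derivatives inside the triangles.  The value 0 on the
   edges, a null set, is a convention: a piecewise polynomial need not be
   differentiable there. *)
Definition grad (f : pt -> R) (x : pt) : pt :=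
  if `[< exists2 s, s \in cells T & (simplex (vert T) s)° x >]
  then ('D_(1, 0) f x, 'D_(0, 1) f x) else 0.

Definition grad_dot (v w : pt -> pt) (x : pt) : R :=
  let v1 := grad (fun y => (v y).1) x in let v2 := grad (fun y => (v y).2) x in
  let w1 := grad (fun y => (w y).1) x in let w2 := grad (fun y => (w y).2) x in
  (v1.1 * w1.1 + v1.2 * w1.2) + (v2.1 * w2.1 + v2.2 * w2.2).

Definition divg (v : pt -> pt) (x : pt) : R :=
  (grad (fun y => (v y).1) x).1 + (grad (fun y => (v y).2) x).2.

Definition infsup : \bar R :=
  ereal_inf [set ereal_sup
      [set (`|intD D (fun x => q x * divg v x)| /
            (Num.sqrt (intD D (grad_dot v v)) *
             Num.sqrt (intD D (fun x => q x ^+ 2))))%:E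
      | v in [set v | V0h v /\ exists2 x, dom D x & v x != 0]]
    | q in [set q | W0h q /\ exists2 x, dom D x & q x != 0]].

Definition stiffness n (phi : 'I_n -> pt -> pt) (w : pt -> R) : 'M[R]_n :=
  \matrix_(i, j) intD D (fun x => w x * grad_dot (phi i) (phi j) x).

Definition divergence_mx p n (vphi : 'I_p -> pt -> R)
    (phi : 'I_n -> pt -> pt) : 'M[R]_(p, n) :=
  \matrix_(i, j) - intD D (fun x => vphi i x * divg (phi j) x).

Definition mass_mx p (vphi : 'I_p -> pt -> R) : 'M[R]_p :=
  \matrix_(i, j) intD D (fun x => vphi i x * vphi j x).

End FiniteElements.

End Plane.

Arguments domain R : clear implicits.
Arguments dom {R} d _.
Arguments dom_open {R} d.
Arguments vert {R D} T i : rename.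

Section StochasticGalerkin.
Context {R : realType}.
Local Notation RM := (measurableTypeR R).

Definition sqrt3 : R := Num.sqrt 3.

Lemma lt_Nsqrt3_sqrt3 : - sqrt3 < sqrt3.
Proof. by rewrite gtrN// sqrtr_gt0. Qed.

Definition uniform1 : probability RM R := uniform_prob lt_Nsqrt3_sqrt3.

Definition cons_pair n (x : RM * n.-tuple RM) : n.+1.-tuple RM :=
  [tuple of x.1 :: x.2].

Lemma measurable_cons_pair n : measurable_fun setT (@cons_pair n).
Proof.
by apply: measurable_cons; [exact: measurable_fst|exact: measurable_snd].
Qed.

HB.instance Definition _ n := isMeasurableFun.Build _ _ _ _ (@cons_pair n)
  (@measurable_cons_pair n).

(* The M-fold product of the uniform probability on [-sqrt 3, sqrt 3]. *)
Fixpoint uniform_cube (M : nat) : probability (M.-tuple RM) R :=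
  if M is M'.+1
  then distribution (uniform1 \x uniform_cube M')%E (@cons_pair M')
  else dirac [tuple].

(* The orthonormal polynomials of the uniform probability on
   [-sqrt 3, sqrt 3], i.e. the normalised Legendre polynomials; the sign of
   the leading coefficient makes them unique. *)
Definition legendre_orthonormal (p : nat -> {poly R}) : Prop :=
  (forall n, size (p n) = n.+1 /\ 0 < lead_coef (p n)) /\
  forall i j, \int[uniform1]_y ((p i).[y] * (p j).[y]) = (i == j)%:R.

Definition enum_multi_index (M k Q : nat)
    (alpha : 'I_Q -> {ffun 'I_M -> nat}) : Prop :=
  injective alpha /\
  forall b : {ffun 'I_M -> nat},
    (\sum_m b m <= k)%N <-> exists i, alpha i = b.

Definition legendre_prod (p : nat -> {poly R}) M (b : {ffun 'I_M -> nat})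
    (y : M.-tuple RM) : R := \prod_m (p (b m)).[tnth y m].

Definition sg_mx M Q (psi : 'I_Q -> M.-tuple RM -> R) (m : 'I_M) : 'M[R]_Q :=
  \matrix_(i, j) \int[uniform_cube M]_y (tnth y m * psi i y * psi j y).

End StochasticGalerkin.

Definition sym_posdef (R : realType) n (H : 'M[R]_n) : Prop :=
  H^T = H /\ forall w : 'cV[R]_n, w != 0 -> 0 < (w^T *m H *m w) 0 0.

(* Main.v *)
Require Import Defs.
From mathcomp Require Import all_boot all_order all_algebra.
From mathcomp Require Import all_classical all_reals all_analysis.
From mathcomp Require Import measurable_realfun ess_sup_inf.
From mathcomp Require Import ring lra.
From mathcomp.real_closed Require Import mxtens.

Set Implicit Arguments.
Unset Strict Implicit.
Unset Printing Implicit Defensive.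

Import Order.TTheory GRing.Theory Num.Theory.
Import numFieldNormedType.Exports.

Local Open Scope classical_set_scope.
Local Open Scope ring_scope.

(* The identity behind the theorem is that of Bramble and Pasciak: for symmetric
   positive definite K, A - K and S, put t = K^-1 (A v + B^T q); then
     w^T H P^-1 C w = (t - v)^T K (t - v) + v^T (A - K) v,   w = (v, q),
   which is nonnegative and vanishes only if v = 0 and B^T q = 0.  Here
   K = a (I (x) A_mg), and inf-sup stability turns B^T q = 0 into q = 0 for
   zero-mean pressures.

   That A - K is positive definite comes from the bound
     calA >= (inf nu_0 - sqrt 3 sigma chi) (I (x) A).
   The form of G_m (x) A_m at v is the expectation of y_m V(y)^T A_m V(y), where
   V(y) = sum_i psi_i(y) v_i; since |y_m| <= sqrt 3 almost surely and
   |u^T A_m u| <= sigma chi_m u^T A u, it is at most sqrt 3 sigma chi_m times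
   the expectation of V^T A V, which is the form of I (x) A by orthonormality.

   No Poincare inequality is used: spectral equivalence with A_mg already forces
   u^T A u <> 0, hence u^T A u > 0, for u <> 0. *)

(** * Integrals of essentially bounded functions *)

Section EssentiallyBounded.
Context d (T : measurableType d) (R : realType).
Variables (mu : {measure set T -> \bar R}) (D : set T).
Implicit Types f g : T -> R.

Lemma ae_mono (P Q : T -> Prop) : (forall x, P x -> Q x) ->
  {ae mu, forall x, P x} -> {ae mu, forall x, Q x}.
Proof. by move=> PQ; apply: filterS. Qed.

(** A class closed under sums and products, unlike plain integrability. It holds the [Linfty]
    weights, the piecewise polynomials with their derivatives, and the coordinates of the uniform
    cube, which are bounded only almost everywhere. *)
Definition ess_bounded f :=
  measurable_fun D f /\ exists C, {ae mu, forall x, D x -> `|f x| <= C}.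

Lemma ess_bounded_le f C : measurable_fun D f ->
  (forall x, D x -> `|f x| <= C) -> ess_bounded f.
Proof. by move=> mf fC; split=> //; exists C; apply: aeW. Qed.

Lemma ess_bounded_cst c : ess_bounded (fun=> c).
Proof. exact: (@ess_bounded_le _ `|c|). Qed.

Lemma ess_boundedD f g : ess_bounded f -> ess_bounded g ->
  ess_bounded (fun x => f x + g x).
Proof.
move=> [mf [C fC]] [mg [C' gC']]; split; first exact: measurable_funD.
exists (C + C'); apply: filterS2 fC gC' => x fC gC' Dx.
by rewrite (le_trans (ler_normD _ _))// lerD ?fC ?gC'.
Qed.

Lemma ess_boundedM f g : ess_bounded f -> ess_bounded g ->
  ess_bounded (fun x => f x * g x).
Proof.
move=> [mf [C fC]] [mg [C' gC']]; split; first exact: measurable_funM.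
exists (C * C'); apply: filterS2 fC gC' => x fC gC' Dx.
by rewrite normrM ler_pM ?fC ?gC'.
Qed.

Lemma ess_bounded_sum (I : Type) (r : seq I) (P : pred I) (F : I -> T -> R) :
  (forall i, ess_bounded (F i)) ->
  ess_bounded (fun x => \sum_(i <- r | P i) F i x).
Proof.
move=> bF; elim: r => [|i r IH].
  under eq_fun do rewrite big_nil; exact: ess_bounded_cst.
under eq_fun do rewrite big_cons.
by case: (P i) => //; exact: ess_boundedD.
Qed.

Lemma ess_bounded_prod (I : Type) (r : seq I) (P : pred I) (F : I -> T -> R) :
  (forall i, ess_bounded (F i)) ->
  ess_bounded (fun x => \prod_(i <- r | P i) F i x).
Proof.
move=> bF; elim: r => [|i r IH].
  under eq_fun do rewrite big_nil; exact: ess_bounded_cst.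
under eq_fun do rewrite big_cons.
by case: (P i) => //; exact: ess_boundedM.
Qed.

Hypotheses (mD : measurable D) (muD : (mu D < +oo)%E).

Lemma ess_bounded_integrable f : ess_bounded f -> mu.-integrable D (EFin \o f).
Proof.
move=> [mf [C fC]]; apply/integrableP; split; first exact/measurable_EFinP.
(* The dominating constant is [|C|], since [C] itself may be negative when [D] is null. *)
apply: (@le_lt_trans _ _ (\int[mu]_(x in D) (`|C|%:E))%E); last first.
  by rewrite integral_cst// lte_mul_pinfty// ?lee_fin.
apply: ae_ge0_le_integral => //.
- by apply/measurableT_comp => //; exact/measurable_EFinP.
- apply: filterS fC => x fC Dx; rewrite /= lee_fin.
  by rewrite (le_trans (fC Dx))// ler_norm.
Qed.

Lemma ess_bounded_RintegralD f g : ess_bounded f -> ess_bounded g ->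
  \int[mu]_(x in D) (f x + g x) = \int[mu]_(x in D) f x + \int[mu]_(x in D) g x.
Proof. by move=> bf bg; apply: RintegralD => //; exact: ess_bounded_integrable. Qed.

Lemma ess_bounded_RintegralZ f c : ess_bounded f ->
  \int[mu]_(x in D) (c * f x) = c * \int[mu]_(x in D) f x.
Proof. by move=> bf; apply: RintegralZl => //; exact: ess_bounded_integrable. Qed.

Lemma ess_bounded_Rintegral_sum (I : Type) (r : seq I) (P : pred I)
    (F : I -> T -> R) : (forall i, ess_bounded (F i)) ->
  \int[mu]_(x in D) (\sum_(i <- r | P i) F i x) =
  \sum_(i <- r | P i) \int[mu]_(x in D) F i x.
Proof.
move=> bF; elim: r => [|i r IH].
  rewrite big_nil; under eq_Rintegral do rewrite big_nil.
  by rewrite Rintegral_cst// mul0r.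
rewrite big_cons; under eq_Rintegral do rewrite big_cons.
case: (P i) => //; rewrite ess_bounded_RintegralD ?IH//.
exact: ess_bounded_sum.
Qed.

Lemma ae_le_Rintegral f g : ess_bounded f -> ess_bounded g ->
  {ae mu, forall x, D x -> f x <= g x} ->
  \int[mu]_(x in D) f x <= \int[mu]_(x in D) g x.
Proof.
move=> bf bg fg.
(* [min f g] lies below [g] everywhere and equals [f] almost everywhere, so pointwise monotonicity
   of the integral applies to it. *)
have bm : ess_bounded (fun x => Num.min (f x) (g x)).
  have [[mf [C fC]] [mg [C' gC']]] := (bf, bg).
  split; first exact: measurable_minr.
  exists (Num.max C C'); apply: filterS2 fC gC' => x fC gC' Dx.
  by rewrite minEle; case: ifP; rewrite le_max ?fC ?gC' ?orbT.
rewrite (_ : \int[mu]_(x in D) f x = \int[mu]_(x in D) Num.min (f x) (g x)).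
  apply: le_Rintegral => //; [exact: ess_bounded_integrable..|].
  by move=> x _; rewrite ge_min lexx orbT.
congr fine; apply: ae_eq_integral => //.
- by apply/measurable_EFinP; case: bf.
- by apply/measurable_EFinP; case: bm.
- by apply: filterS fg => x fg Dx; rewrite min_l// fg.
Qed.

End EssentiallyBounded.

(** * The Bramble-Pasciak preconditioner *)

Section SaddlePoint.
Context {R : realType}.

Lemma sym_posdef_unitmx n (K : 'M[R]_n) : sym_posdef K -> K \in unitmx.
Proof.
move=> [_ posK]; rewrite unitmxE unitfE; apply/negP => /det0P[v v0 vK].
have /posK : v^T != 0 by rewrite trmx_eq0.
by rewrite trmxK vK mul0mx mxE ltxx.
Qed.

Lemma sym_posdef_ge0 n (K : 'M[R]_n) : sym_posdef K ->
  forall w : 'cV[R]_n, 0 <= (w^T *m K *m w) 0 0.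
Proof.
move=> [_ posK] w; have [->|/posK/ltW//] := eqVneq w 0.
by rewrite mulmx0 mxE.
Qed.

Lemma sym_posdef_eq0 n (K : 'M[R]_n) (w : 'cV[R]_n) : sym_posdef K ->
  (w^T *m K *m w) 0 0 <= 0 -> w = 0.
Proof.
move=> [_ posK] wKw; apply/eqP/negPn/negP => /posK.
by rewrite ltNge wKw.
Qed.

Lemma sym_posdefZ n (K : 'M[R]_n) (c : R) : 0 < c -> sym_posdef K ->
  sym_posdef (c *: K).
Proof.
move=> c0 [symK posK]; split=> [|w /posK wKw]; first by rewrite linearZ /= symK.
by rewrite -scalemxAr -scalemxAl mxE mulr_gt0.
Qed.

Lemma sym_posdef_block n p (K : 'M[R]_n) (S : 'M[R]_p) :
  sym_posdef K -> sym_posdef S -> sym_posdef (block_mx K 0 0 S).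
Proof.
move=> pK pS; split; first by rewrite tr_block_mx !trmx0 pK.1 pS.1.
move=> w; rewrite -[w]vsubmxK; move: (usubmx w) (dsubmx w) => v q w0.
rewrite tr_col_mx mul_row_block !mulmx0 addr0 add0r mul_row_col mxE.
have [v0|v0] := eqVneq v 0; last first.
  by rewrite ltr_pwDl ?(sym_posdef_ge0 pS)//; apply: pK.2.
rewrite ltr_wpDl ?(sym_posdef_ge0 pK)//; apply: pS.2.
by apply: contraNneq w0 => ->; rewrite v0 col_mx0.
Qed.

Section BramblePasciak.
Variables (n p : nat) (A K : 'M[R]_n) (B : 'M[R]_(p, n)) (S : 'M[R]_p).
Hypotheses (posK : sym_posdef K) (posAK : sym_posdef (A - K))
  (posS : sym_posdef S).

Let C := block_mx A B^T B 0.
Let P := block_mx K 0 B (- S).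
Let H := block_mx (A - K) 0 0 S.

(** The determinant factors as that of [K] times that of [- S]. *)
Lemma block_triangular_unitmx : P \in unitmx.
Proof.
rewrite unitmxE det_lblock unitrM -!unitmxE sym_posdef_unitmx// -scaleN1r.
by rewrite unitmxZ ?sym_posdef_unitmx// unitrN unitr1.
Qed.

Let symA : A^T = A.
Proof. by have := posAK.1; rewrite linearB /= posK.1 => /addIr. Qed.

Let X := invmx K.

(** Multiplying the right-hand side by [P] gives back [C]. *)
Lemma preconditioned_saddle : invmx P *m C =
  block_mx (X *m A) (X *m B^T)
    (invmx S *m (B *m X *m A - B)) (invmx S *m (B *m X *m B^T)).
Proof.
have uK := sym_posdef_unitmx posK; have uS := sym_posdef_unitmx posS.
rewrite -[RHS](mulKmx block_triangular_unitmx); congr (_ *m _).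
rewrite mulmx_block !mul0mx !addr0 !mulNmx !mulKVmx//.
by rewrite !mulmxA opprB addrCA subrr addr0 subrr.
Qed.

(** In the lower blocks [S] cancels [invmx S]; in the upper ones [(A - K) *m X = A *m X - 1]. The
    result is visibly symmetric. *)
Lemma scaled_preconditioned_saddle : H *m (invmx P *m C) =
  block_mx (A *m X *m A - A) ((A *m X - 1%:M) *m B^T)
    (B *m (X *m A - 1%:M)) (B *m X *m B^T).
Proof.
have uK := sym_posdef_unitmx posK; have uS := sym_posdef_unitmx posS.
rewrite preconditioned_saddle mulmx_block !mul0mx !addr0 !add0r !mulKVmx//.
by rewrite !mulmxBl !mulmxBr !mulKVmx// !mul1mx !mulmx1 !mulmxA.
Qed.

Lemma preconditioned_saddle_sym :
  H *m (invmx P *m C) = (invmx P *m C)^T *m H.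
Proof.
have symX : X^T = X by rewrite trmx_inv posK.1.
have symH : H^T = H by rewrite tr_block_mx !trmx0 posAK.1 posS.1.
rewrite -[H in RHS]symH -trmx_mul scaled_preconditioned_saddle tr_block_mx.
have trB m k (M N : 'M[R]_(m, k)) : (M - N)^T = M^T - N^T by rewrite linearB.
congr block_mx.
- by rewrite trB !trmx_mul symA symX mulmxA.
- by rewrite trmx_mul trB trmx_mul symA symX trmx1.
- by rewrite trmx_mul trmxK trB trmx_mul symA symX trmx1.
- by rewrite !trmx_mul trmxK symX mulmxA.
Qed.

(** Writing [s = K *m t] for [A *m v + B^T *m q] removes every inverse, and both sides become the
    same combination of bilinear terms in [v], [q] and [t]. *)
Lemma preconditioned_saddle_form (v : 'cV[R]_n) (q : 'cV[R]_p)
    (t := X *m (A *m v + B^T *m q)) :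
  (col_mx v q)^T *m (H *m (invmx P *m C)) *m col_mx v q =
  (t - v)^T *m K *m (t - v) + v^T *m (A - K) *m v.
Proof.
have uK := sym_posdef_unitmx posK.
set s := A *m v + B^T *m q.
have Kt : K *m t = s by rewrite /t mulKVmx.
have tK : t^T *m K = s^T by rewrite -Kt [(K *m t)^T]trmx_mul posK.1.
have sE : s^T = v^T *m A + q^T *m B.
  by rewrite /s linearD /= !trmx_mul trmxK symA.
rewrite scaled_preconditioned_saddle -mulmxA mul_block_col tr_col_mx mul_row_col.
rewrite !mulmxBl !mulmxBr -!mulmxA.
rewrite (_ : A *m (X *m (A *m v)) - A *m v +
  (A *m (X *m (B^T *m q)) - 1%:M *m (B^T *m q)) = A *m t - s); last first.
  by rewrite /t /s !mulmxDr mul1mx opprD addrACA.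
rewrite mulmxBl -!mulmxA mul1mx mulmxBr.
rewrite (_ : B *m (X *m (A *m v)) - B *m v + B *m (X *m (B^T *m q)) =
  B *m t - B *m v); last by rewrite addrAC -mulmxDr -mulmxDr.
have -> : (t - v)^T = t^T - v^T by rewrite linearB.
(* Both products are [t^T *m K *m t], by symmetry of [K]. *)
have st : t^T *m s = s^T *m t by rewrite -tK -mulmxA Kt.
rewrite !mulmxBl !mulmxBr Kt st (mulmxA t^T K v) tK sE !mulmxDl !mulmxA.
apply/matrixP => i j; rewrite !mxE; ring.
Qed.

(** If the sum of the two nonnegative terms were at most 0, both would vanish: then [v = 0], so
    [t = v = 0] and [B^T *m q = K *m t = 0]. *)
Lemma preconditioned_saddle_pos (v : 'cV[R]_n) (q : 'cV[R]_p) :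
  (B^T *m q = 0 -> q = 0) -> col_mx v q != 0 ->
  0 < ((col_mx v q)^T *m (H *m (invmx P *m C)) *m col_mx v q) 0 0.
Proof.
move=> Bq0 w0; rewrite preconditioned_saddle_form mxE ltNge; apply/negP => le0.
set t := X *m _ in le0.
have tv := sym_posdef_ge0 posK (t - v); have vv := sym_posdef_ge0 posAK v.
have v0 : v = 0 by apply: (sym_posdef_eq0 posAK); lra.
have : t - v = 0 by apply: (sym_posdef_eq0 posK); lra.
rewrite /t v0 mulmx0 add0r subr0 => XBq.
move/eqP: w0; apply; rewrite v0 Bq0 ?col_mx0//.
by rewrite -[LHS](mulKVmx (sym_posdef_unitmx posK)) XBq mulmx0.
Qed.

End BramblePasciak.
End SaddlePoint.

(** * Polynomials in the plane *)

Section PlanePolynomials.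
Context {R : realType}.
Local Notation pt := (R * R)%type.
Local Notation mpt := (measurableTypeR R * measurableTypeR R)%type.

(** Polynomial functions presented by generators, so that measurability, boundedness and
    differentiability are each one induction without degree bookkeeping. *)
Inductive plane_poly : (pt -> R) -> Prop :=
| plane_poly_cst c : plane_poly (fun=> c)
| plane_poly_fst : plane_poly fst
| plane_poly_snd : plane_poly snd
| plane_polyD f g : plane_poly f -> plane_poly g -> plane_poly (f \+ g)
| plane_polyM f g : plane_poly f -> plane_poly g -> plane_poly (f \* g).

Lemma plane_polyX f n : plane_poly f -> plane_poly (fun x => f x ^+ n).
Proof.
move=> pf; elim: n => [|n IH]; first exact: plane_poly_cst.
rewrite (_ : (fun x => _) = f \* (fun x => f x ^+ n)); first exact: plane_polyM.
by apply/funext => x /=; rewrite exprS.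
Qed.

Lemma plane_poly_sum (I : Type) (r : seq I) (F : I -> pt -> R) :
  (forall i, plane_poly (F i)) -> plane_poly (fun x => \sum_(i <- r) F i x).
Proof.
move=> pF; elim: r => [|i r IH].
  by under eq_fun do rewrite big_nil; exact: plane_poly_cst.
by under eq_fun do rewrite big_cons; exact: plane_polyD.
Qed.

Lemma plane_poly_deg_le k p : poly_deg_le k p -> plane_poly p.
Proof.
move=> [c pE]; rewrite (_ : p = fun x => \sum_(i < k.+1) \sum_(j < k.+1 - i)
  ((c i j)%:A * x.1 ^+ i * x.2 ^+ j)); last first.
  by apply/funext => x; rewrite pE; apply: eq_bigr => i _; apply: eq_bigr => j _;
    rewrite -[(c i j)%:A]/(c i j * 1) mulr1.
apply: plane_poly_sum => i; apply: plane_poly_sum => j.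
apply: plane_polyM; last exact/plane_polyX/plane_poly_snd.
apply: plane_polyM; last exact/plane_polyX/plane_poly_fst.
exact: plane_poly_cst.
Qed.

Lemma plane_poly_measurable f : plane_poly f ->
  measurable_fun setT (f : mpt -> R).
Proof.
elim=> {f} [c|||f g _ mf _ mg|f g _ mf _ mg].
- exact: measurable_cst.
- exact: measurable_fst.
- exact: measurable_snd.
- exact: measurable_funD.
- exact: measurable_funM.
Qed.

Lemma plane_poly_bounded f (D : set pt) : bounded_set D -> plane_poly f ->
  exists C, forall x, D x -> `|f x| <= C.
Proof.
move=> /pinfty_ex_gt0[M M0 DM].
elim=> {f} [c|||f g _ [C fC] _ [C' gC']|f g _ [C fC] _ [C' gC']].
- by exists `|c|.
- by exists M => x /DM; apply: le_trans; rewrite prod_normE/= le_max lexx.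
- by exists M => x /DM; apply: le_trans; rewrite prod_normE/= le_max lexx orbT.
- exists (C + C') => x Dx /=.
  by rewrite (le_trans (ler_normD _ _))// lerD ?fC ?gC'.
- exists (C * C') => x Dx /=.
  by rewrite normrM ler_pM ?fC ?gC'.
Qed.

(** The difference quotient of a coordinate is constant away from 0. *)
Lemma is_derive_fst (x v : pt) : is_derive x v (@fst R R) v.1.
Proof.
have h : (fun h : R => h^-1 *: ((h *: v + x).1 - x.1)) @ 0^' --> v.1.
  apply: cvg_near_cst; near=> h; rewrite /= addrK.
  rewrite [_ *: _]mulrA mulVf ?mul1r//.
  by near: h; exact: nbhs_dnbhs_neq.
by apply: DeriveDef; [apply/cvg_ex; exists v.1|exact: cvg_lim].
Unshelve. all: by end_near. Qed.

Lemma is_derive_snd (x v : pt) : is_derive x v (@snd R R) v.2.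
Proof.
have h : (fun h : R => h^-1 *: ((h *: v + x).2 - x.2)) @ 0^' --> v.2.
  apply: cvg_near_cst; near=> h; rewrite /= addrK.
  rewrite [_ *: _]mulrA mulVf ?mul1r//.
  by near: h; exact: nbhs_dnbhs_neq.
by apply: DeriveDef; [apply/cvg_ex; exists v.2|exact: cvg_lim].
Unshelve. all: by end_near. Qed.

Lemma plane_poly_derive f v : plane_poly f ->
  exists2 g, plane_poly g & forall x, is_derive x v f (g x).
Proof.
elim=> {f} [c|||f1 f2 _ [g1 p1 d1] _ [g2 p2 d2]|f1 f2 pf1 [g1 p1 d1] pf2 [g2 p2 d2]].
- by exists (fun=> 0) => [|x]; [exact: plane_poly_cst|exact: is_derive_cst].
- by exists (fun=> v.1) => [|x]; [exact: plane_poly_cst|exact: is_derive_fst].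
- by exists (fun=> v.2) => [|x]; [exact: plane_poly_cst|exact: is_derive_snd].
- by exists (g1 \+ g2) => [|x]; [exact: plane_polyD|exact: is_deriveD].
- exists ((f1 \* g2) \+ (f2 \* g1)) => [|x]; last exact: is_deriveM.
  by apply: plane_polyD; exact: plane_polyM.
Qed.

End PlanePolynomials.

(** * Planar measure of bounded sets and of open sets *)

Section Area.
Context {R : realType}.
Local Notation pt := (R * R)%type.
Local Notation mpt := (measurableTypeR R * measurableTypeR R)%type.
Local Notation area := (@area R).

Lemma area_bounded_lty (D : set pt) : measurable (D : set mpt) ->
  bounded_set D -> (area D < +oo)%E.
Proof.
move=> mD /pinfty_ex_gt0[M M0 DM].
pose I : set R := [set` `[- M, M]].
have mI : measurable (I : set (measurableTypeR R)) by exact: measurable_itv.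
apply: (@le_lt_trans _ _ (area ((I : set (measurableTypeR R)) `*` I))).
  apply: le_measure; rewrite ?inE//; first exact: measurableX.
  move=> x /DM/=; rewrite prod_normE/= ge_max => /andP[].
  by rewrite !ler_norml /I/= !in_itv/=.
rewrite /Defs.area product_measure1E//= /I lebesgue_measure_itv/=.
by case: ifPn => _; rewrite ?mule0 -?EFinD -?EFinM ltry.
Qed.

(** A ball of the maximum norm is a product of two intervals, whose area is explicit. *)
Lemma area_open_gt0 (U : set pt) : open U -> U !=set0 -> (0 < area U)%E.
Proof.
move=> oU [p Up].
have /nbhs_ballP[e /= e0 peU] : nbhs p U by exact: open_nbhs_nbhs.
have mb (z : R) : measurable (ball z e : set (measurableTypeR R)).
  exact: measurable_ball.
apply: (@lt_le_trans _ _ (area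
    ((ball p.1 e : set (measurableTypeR R)) `*` ball p.2 e))); last first.
  apply: le_measure; rewrite ?inE//; first exact: measurableX.
    exact: open_measurable_plane.
rewrite /Defs.area product_measure1E//= !lebesgue_measure_ball ?ltW//.
by rewrite -EFinM lte_fin mulr_gt0// pmulrn_rgt0.
Qed.

End Area.

(** * Finite element functions *)

Section FiniteElementFunctions.
Context {R : realType} (D : domain R) (T : triangulation D).
Local Notation pt := (R * R)%type.
Local Notation mpt := (measurableTypeR R * measurableTypeR R)%type.
Local Notation area := (@area R).
Local Notation cell := (simplex (vert T)).

Lemma dom_measurable : measurable (dom D : set mpt).
Proof. exact: (open_measurable_plane (dom_open D)). Qed.

Lemma dom_area_lty : (area (dom D) < +oo)%E.
Proof. by apply: area_bounded_lty; [exact: dom_measurable|exact: dom_bounded]. Qed.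

Lemma cell_closure s x : s \in cells T -> cell s x -> closure (dom D) x.
Proof. by move=> sT sx; rewrite (tri_cover T); exists s. Qed.

Lemma dom_cell x : dom D x -> exists2 s, s \in cells T & cell s x.
Proof.
move=> Dx; have : closure (dom D) x by exact: subset_closure.
by rewrite (tri_cover T) => -[s sT sx]; exists s.
Qed.

(** There are finitely many cells, and the sum of the absolute values of the local constants
    dominates each of them. *)
Lemma cells_bound (Q : {set 'I_(nvert T)} -> R -> Prop) :
  (forall s a b, a <= b -> Q s a -> Q s b) ->
  (forall s, s \in cells T -> exists C, Q s C) ->
  exists C, forall s, s \in cells T -> Q s C.
Proof.
move=> Qle QC; have /choice[C HC] : forall s, exists c, s \in cells T -> Q s c.
  move=> s; case: (boolP (s \in cells T)) => [/QC[C HC]|_].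
    by exists C.
  by exists 0.
exists (\sum_s `|C s|) => s /HC; apply: Qle.
by rewrite (bigD1 s)//= (le_trans (ler_norm _))// lerDl sumr_ge0.
Qed.

Lemma cont_pw_poly_bounded k f : cont_pw_poly T k f ->
  exists C, forall x, dom D x -> `|f x| <= C.
Proof.
move=> [_ pf].
have [s a b ab Qa x Dx sx|s sT|C HC] := @cells_bound
    (fun s C => forall x, dom D x -> cell s x -> `|f x| <= C).
- exact: le_trans (Qa _ _ _) ab.
- have [p /plane_poly_deg_le pp fp] := pf s sT.
  have [C pC] := plane_poly_bounded (dom_bounded D) pp.
  by exists C => x Dx sx; rewrite fp// pC.
- exists C => x Dx; have [s sT sx] := dom_cell Dx.
  exact: HC sx.
Qed.

(** As [D] is open, the part in [D] of the preimage of an open interval is open in the plane, hence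
    measurable for the product sigma-algebra. *)
Lemma within_continuous_measurable (f : pt -> R) :
  {within closure (dom D), continuous f} ->
  measurable_fun (dom D : set mpt) (f : mpt -> R).
Proof.
move=> /subspace_continuousP cf mD.
apply: (measurability _ (RGenOpens.measurableE R)) => //.
move=> _ [_ [a [b ->] <-]]; apply: open_measurable_plane.
rewrite openE => x [Dx fx]; apply: filterI.
  by apply: open_nbhs_nbhs; split=> //; exact: dom_open.
have cx : closure (dom D) x by exact: subset_closure.
have nab : nbhs (f x) `]a, b[%classic.
  by apply: open_nbhs_nbhs; split=> //; exact: itv_open.
have /= fab := cf x cx _ nab.
have nD : nbhs x (dom D) by apply: open_nbhs_nbhs; split=> //; exact: dom_open.
by apply: filterS2 nD fab => y Dy; apply; exact: subset_closure.
Qed.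

Lemma cont_pw_poly_ess_bounded k f : cont_pw_poly T k f ->
  ess_bounded area (dom D : set mpt) f.
Proof.
move=> pf; have [C fC] := cont_pw_poly_bounded pf.
apply: (@ess_bounded_le _ mpt R area _ _ _ _ fC).
by apply: within_continuous_measurable; case: pf.
Qed.

Let inside (x : pt) := exists2 s, s \in cells T & (cell s)° x.

(** Near an interior point of a cell, [f] coincides with a polynomial, and a derivative depends only
    on nearby values. *)
Lemma cont_pw_poly_derive k f v : cont_pw_poly T k f ->
  exists g : {set 'I_(nvert T)} -> pt -> R,
    (forall s, plane_poly (g s)) /\
    forall s x, s \in cells T -> (cell s)° x -> is_derive x v f (g s x).
Proof.
move=> [_ pf].
have /choice[g Hg] : forall s, exists h, plane_poly h /\
    forall x, s \in cells T -> (cell s)° x -> is_derive x v f (h x).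
  move=> s; have [sT|sT] := boolP (s \in cells T); last first.
    by exists (fun=> 0); split=> //; exact: plane_poly_cst.
  have [p /plane_poly_deg_le pp fp] := pf s sT.
  have [g pg dg] := plane_poly_derive v pp.
  exists g; split=> // x _ sx.
  apply: near_eq_is_derive (dg x).
  by apply: filterS sx => y sy; rewrite fp.
by exists g; split=> [s|s x sT sx]; have [] := Hg s => // _; apply.
Qed.

(** A single directional component of [grad], with the same value 0 off the open cells; [grad] and
    [divg] are assembled from it. *)
Definition pw_derive (v : pt) (f : pt -> R) (x : pt) : R :=
  if `[< inside x >] then 'D_v f x else 0.

Lemma grad_pw_derive f x :
  grad T f x = (pw_derive (1, 0) f x, pw_derive (0, 1) f x).
Proof. by rewrite /grad /pw_derive; case: asboolP. Qed.

Lemma pw_derive_ess_bounded k v f : cont_pw_poly T k f ->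
  ess_bounded area (dom D : set mpt) (pw_derive v f).
Proof.
move=> pf; have [g [pg dg]] := cont_pw_poly_derive v pf.
have gE s x : s \in cells T -> (cell s)° x -> pw_derive v f x = g s x.
  move=> sT sx; rewrite /pw_derive asboolT; last by exists s.
  by have := dg s x sT sx => -[].
have [s a b ab Qa x Dx|s _|C HC] := @cells_bound
    (fun s C => forall x, dom D x -> `|g s x| <= C).
- exact: le_trans (Qa _ _) ab.
- exact: plane_poly_bounded (dom_bounded D) (pg s).
apply: (@ess_bounded_le _ mpt R area _ _ `|C|) => [|x Dx]; last first.
  have [[s sT sx]|nx] := pselect (inside x).
    by rewrite (gE s)// (le_trans (HC s sT x Dx))// ler_norm.
  by rewrite /pw_derive asboolF// normr0.
apply: measurable_funS measurableT _ _ => // _ Y mY; rewrite setTI.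
have mI s : measurable ((cell s)° : set mpt).
  by apply: open_measurable_plane; exact: open_interior.
(* For measurability: the derivative is a polynomial on each open cell and 0 off their union [U], so
   a preimage is a finite union of measurable pieces. *)
pose U := \bigcup_(s in [set` cells T]) ((cell s)° : set mpt).
have mU : measurable U by apply: fin_bigcup_measurable.
rewrite (_ : _ @^-1` _ =
  \bigcup_(s in [set` cells T]) ((cell s)° `&` g s @^-1` Y) `|`
  (~` U `&` (fun=> 0) @^-1` Y)).
  apply: measurableU.
    apply: fin_bigcup_measurable => // s _; apply: measurableI => //.
    by rewrite -[X in measurable X]setTI; exact: plane_poly_measurable.
  apply: measurableI; first exact: measurableC.
  by rewrite -[X in measurable X]setTI; exact: measurable_cst.
apply/seteqP; split=> [x Yx|x [[s sT [sx]]|[Ux]]].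
- have [[s sT sx]|nx] := pselect (inside x).
    by left; exists s => //; split=> //; rewrite /preimage/= -gE.
  right; split=> [[s sT sx]|]; first by apply: nx; exists s.
  by move: Yx; rewrite /preimage/= /pw_derive asboolF.
- by rewrite /preimage/= -gE.
- by rewrite /preimage/= /pw_derive asboolF.
Qed.

(** The expansion of [f] holds on whole cells, hence near each interior point of a cell; off the
    open cells both sides are 0. *)
Lemma pw_derive_sum k n (c : 'I_n -> R) (F : 'I_n -> pt -> R) f v :
  (forall i, cont_pw_poly T k (F i)) ->
  (forall x, closure (dom D) x -> f x = \sum_i c i * F i x) ->
  forall x, pw_derive v f x = \sum_i c i * pw_derive v (F i) x.
Proof.
move=> pF fE x; rewrite /pw_derive; case: asboolP => [[s sT sx]|]; last first.
  by rewrite big1// => i _; rewrite mulr0.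
have dF i : is_derive x v (F i) ('D_v (F i) x).
  have [g [_ dg]] := cont_pw_poly_derive v (pF i).
  by have d := dg s x sT sx; rewrite derive_val.
rewrite (_ : \sum_i _ = \sum_i c i *: 'D_v (F i) x) //.
have [] // : is_derive x v f (\sum_i c i *: 'D_v (F i) x).
apply: (@near_eq_is_derive _ _ _ (\sum_i (c i \*: F i))).
apply: filterS sx => y sy; rewrite fct_sumE fE//.
exact: cell_closure sy.
Qed.

End FiniteElementFunctions.

(** * Stiffness forms *)

Section StiffnessForm.
Context {R : realType} (D : domain R) (T : triangulation D).
Context (n : nat) (phi : 'I_n -> R * R -> R * R).
Hypothesis phi_V0h : forall i, V0h T (phi i).
Local Notation pt := (R * R)%type.
Local Notation mpt := (measurableTypeR R * measurableTypeR R)%type.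
Local Notation area := (@area R).
Local Notation bounded_on_D := (ess_bounded area (dom D : set mpt)).
Local Notation form A u := ((u^T *m A *m u) 0 0).

Let g (v : pt) (i : 'I_n) x := pw_derive T v (fun y => (phi i y).1) x.
Let h (v : pt) (i : 'I_n) x := pw_derive T v (fun y => (phi i y).2) x.

Let gb v i : bounded_on_D (g v i).
Proof. by have [p1 _ _] := phi_V0h i; exact: pw_derive_ess_bounded p1. Qed.

Let hb v i : bounded_on_D (h v i).
Proof. by have [_ p2 _] := phi_V0h i; exact: pw_derive_ess_bounded p2. Qed.

Let grad_dotE i j x : grad_dot T (phi i) (phi j) x =
  (g (1, 0) i x * g (1, 0) j x + g (0, 1) i x * g (0, 1) j x) +
  (h (1, 0) i x * h (1, 0) j x + h (0, 1) i x * h (0, 1) j x).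
Proof. by rewrite /grad_dot !grad_pw_derive. Qed.

Lemma grad_dot_ess_bounded i j : bounded_on_D (grad_dot T (phi i) (phi j)).
Proof.
rewrite (funext (grad_dotE i j)).
by do !apply: ess_boundedD; apply: ess_boundedM.
Qed.

Lemma divg_ess_bounded i : bounded_on_D (divg T (phi i)).
Proof.
rewrite (_ : divg T (phi i) = fun x => g (1, 0) i x + h (0, 1) i x).
  exact: ess_boundedD.
by apply/funext => x; rewrite /divg !grad_pw_derive.
Qed.

(** The squared gradient norm at [x] of the finite element function with coefficients [u]. *)
Definition energy (u : 'cV[R]_n) (x : pt) : R :=
  \sum_i \sum_j u i 0 * u j 0 * grad_dot T (phi i) (phi j) x.

(** It is the sum of the squares of the four partial derivatives of the two components. *)
Lemma energy_ge0 u x : 0 <= energy u x.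
Proof.
rewrite (_ : energy u x =
  ((\sum_i u i 0 * g (1, 0) i x) ^+ 2 + (\sum_i u i 0 * g (0, 1) i x) ^+ 2) +
  ((\sum_i u i 0 * h (1, 0) i x) ^+ 2 + (\sum_i u i 0 * h (0, 1) i x) ^+ 2)).
  by rewrite !addr_ge0// sqr_ge0.
have sqE (a : 'I_n -> R) : (\sum_i u i 0 * a i) ^+ 2 =
    \sum_i \sum_j u i 0 * u j 0 * (a i * a j).
  rewrite expr2 big_distrlr; apply: eq_bigr => i _; apply: eq_bigr => j _.
  by rewrite mulrACA.
rewrite !sqE -!big_split; apply: eq_bigr => i _.
rewrite /= -!big_split; apply: eq_bigr => j _.
by rewrite /= grad_dotE !mulrDr.
Qed.

Lemma energy_ess_bounded u : bounded_on_D (energy u).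
Proof.
apply: ess_bounded_sum => i; apply: ess_bounded_sum => j.
by apply: ess_boundedM (grad_dot_ess_bounded i j); exact: ess_bounded_cst.
Qed.

Lemma stiffness_form w u : bounded_on_D w ->
  form (stiffness T phi w) u = intD D (fun x => w x * energy u x).
Proof.
move=> bw; have mD := dom_measurable D; have DT := dom_area_lty D.
have be i j : bounded_on_D (fun x => w x * grad_dot T (phi i) (phi j) x).
  exact: ess_boundedM (grad_dot_ess_bounded i j).
have bc i j : bounded_on_D (fun x =>
    (u i 0 * u j 0) * (w x * grad_dot T (phi i) (phi j) x)).
  by apply: ess_boundedM (be i j); exact: ess_bounded_cst.
rewrite /intD (_ : (fun x => _) = fun x => \sum_i \sum_j
    (u i 0 * u j 0) * (w x * grad_dot T (phi i) (phi j) x)); last first.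
  apply/funext => x; rewrite /energy mulr_sumr; apply: eq_bigr => i _.
  by rewrite mulr_sumr; apply: eq_bigr => j _; rewrite mulrCA.
rewrite ess_bounded_Rintegral_sum//; last by move=> i; exact: ess_bounded_sum.
rewrite mxE; under eq_bigr do rewrite mxE mulr_suml.
rewrite exchange_big /=; apply: eq_bigr => i _.
rewrite ess_bounded_Rintegral_sum//; apply: eq_bigr => j _.
by rewrite ess_bounded_RintegralZ// !mxE /intD mulrAC.
Qed.

Lemma stiffness_sym (w : pt -> R) : (stiffness T phi w)^T = stiffness T phi w.
Proof.
apply/matrixP => i j; rewrite !mxE; congr intD; apply/funext => x.
rewrite !grad_dotE.
move: (g (1, 0) i x) (g (0, 1) i x) (h (1, 0) i x) (h (0, 1) i x)
    (g (1, 0) j x) (g (0, 1) j x) (h (1, 0) j x) (h (0, 1) j x).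
by move=> *; ring.
Qed.

Lemma stiffness1_form u :
  form (stiffness T phi (fun=> 1)) u = intD D (energy u).
Proof.
rewrite stiffness_form; last exact: ess_bounded_cst.
by congr intD; apply/funext => x; rewrite mul1r.
Qed.

Lemma stiffness1_form_ge0 (u : 'cV[R]_n) : 0 <= form (stiffness T phi (fun=> 1)) u.
Proof.
by rewrite stiffness1_form; apply: Rintegral_ge0 => x _; exact: energy_ge0.
Qed.

(** Since the energy is nonnegative, an almost sure bound on the weight survives multiplication by
    it and integration. *)
Lemma stiffness_form_ge (w : pt -> R) c (u : 'cV[R]_n) : bounded_on_D w ->
  {ae area, forall x, dom D x -> c <= w x} ->
  c * form (stiffness T phi (fun=> 1)) u <= form (stiffness T phi w) u.
Proof.
move=> bw cw; have mD := dom_measurable D; have DT := dom_area_lty D.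
have be := energy_ess_bounded u.
rewrite stiffness1_form stiffness_form// /intD -ess_bounded_RintegralZ//.
apply: ae_le_Rintegral => //.
- by apply: ess_boundedM be; exact: ess_bounded_cst.
- exact: ess_boundedM be.
- by apply: ae_mono cw => x cw /cw; apply: ler_wpM2r; exact: energy_ge0.
Qed.

Lemma stiffness_form_le (w : pt -> R) c (u : 'cV[R]_n) : bounded_on_D w ->
  {ae area, forall x, dom D x -> w x <= c} ->
  form (stiffness T phi w) u <= c * form (stiffness T phi (fun=> 1)) u.
Proof.
move=> bw cw; have mD := dom_measurable D; have DT := dom_area_lty D.
have be := energy_ess_bounded u.
rewrite stiffness1_form stiffness_form// /intD -ess_bounded_RintegralZ//.
apply: ae_le_Rintegral => //.
- exact: ess_boundedM be.
- by apply: ess_boundedM be; exact: ess_bounded_cst.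
- by apply: ae_mono cw => x cw /cw; apply: ler_wpM2r; exact: energy_ge0.
Qed.

Lemma stiffness_form_norm_le (w : pt -> R) c (u : 'cV[R]_n) : bounded_on_D w ->
  {ae area, forall x, dom D x -> `|w x| <= c} ->
  `|form (stiffness T phi w) u| <= c * form (stiffness T phi (fun=> 1)) u.
Proof.
move=> bw cw; rewrite ler_norml -mulNr; apply/andP; split.
  apply: stiffness_form_ge => //; apply: ae_mono cw => x cw /cw.
  by rewrite ler_norml => /andP[].
apply: stiffness_form_le => //; apply: ae_mono cw => x cw /cw.
by rewrite ler_norml => /andP[].
Qed.

End StiffnessForm.

(** * Almost-everywhere bounds for the viscosity weights *)

Section LinftyWeights.
Context {R : realType} (D : domain R).
Local Notation mpt := (measurableTypeR R * measurableTypeR R)%type.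
Local Notation area := (@area R).

Lemma ae_area_on (P : R * R -> Prop) :
  {ae area_on D, forall x, P x} -> {ae area, forall x, dom D x -> P x}.
Proof.
move=> [N [mN N0 PN]]; exists (N `&` dom D); split => //.
  by apply: measurableI => //; exact: dom_measurable.
by move=> x /= /not_implyP[Dx nPx]; split=> //; apply: PN.
Qed.

Lemma Linfty_norm_ge0 f : (0 <= Linfty_norm D f)%E.
Proof. exact: Lnorm_ge0. Qed.

Lemma Linfty_norm_fin f : Linfty D f -> Linfty_norm D f \is a fin_num.
Proof. by move=> [_ fy]; rewrite ge0_fin_numE ?Linfty_norm_ge0. Qed.

Lemma Linfty_ae f : Linfty D f ->
  {ae area, forall x, dom D x -> `|f x| <= fine (Linfty_norm D f)}.
Proof.
move=> Df; apply: ae_area_on.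
(* The norm is the essential supremum only for a measure of positive mass and is 0 by convention
   otherwise; in the latter case the whole plane is a null set. *)
have [D0|D0] := ltP 0%E (area_on D setT).
  have := ess_sup_ge (area_on D) (abse \o (EFin \o f)).
  apply: filterS => x /=; rewrite -lee_fin fineK ?Linfty_norm_fin//.
  by rewrite /Linfty_norm unlock /= D0.
exists setT; split=> //; apply/eqP; rewrite eq_le D0 /=.
exact: (measure_ge0 (area_on D)).
Qed.

Lemma Linfty_ess_bounded f : Linfty D f ->
  ess_bounded area (dom D : set mpt) f.
Proof.
by move=> Df; split; [case: Df|exists (fine (Linfty_norm D f)); exact: Linfty_ae].
Qed.

Lemma ess_inf_on_ae f : (0 < ess_inf_on D f)%E ->
  {ae area, forall x, dom D x -> fine (ess_inf_on D f) <= f x}.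
Proof.
move=> f0; apply: ae_area_on.
have := ess_inf_le (area_on D) (EFin \o f); rewrite -/(ess_inf_on D f).
(* [fine] sends infinite values to 0: positivity excludes [-oo], and a bound of [f x] from below by
   [+oo] is contradictory. *)
by apply: filterS => x /=; case: (ess_inf_on D f) f0.
Qed.

End LinftyWeights.

(** * The pressure space and inf-sup stability *)

Section PressureSpace.
Context {R : realType} (D : domain R) (T : triangulation D).
Local Notation pt := (R * R)%type.
Local Notation mpt := (measurableTypeR R * measurableTypeR R)%type.
Local Notation area := (@area R).
Local Notation bounded_on_D := (ess_bounded area (dom D : set mpt)).

Lemma poly_deg_le_cst k c : poly_deg_le k (fun=> c : R).
Proof.
exists (fun i j => if (i == 0%N) && (j == 0%N) then c else 0) => x.
rewrite big_ord_recl /= subn0 big_ord_recl /= expr0 !mulr1.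
by rewrite !big1 ?addr0// => i _; rewrite ?big1 ?mul0r// => j _; rewrite !mul0r.
Qed.

Lemma poly_deg_leD k (f g : pt -> R) : poly_deg_le k f -> poly_deg_le k g ->
  poly_deg_le k (fun x => f x + g x).
Proof.
move=> [a fE] [b gE]; exists (fun i j => a i j + b i j) => x.
rewrite fE gE -big_split; apply: eq_bigr => i _.
by rewrite -big_split; apply: eq_bigr => j _; rewrite /= !mulrDl.
Qed.

Lemma poly_deg_leZ k c (f : pt -> R) : poly_deg_le k f ->
  poly_deg_le k (fun x => c * f x).
Proof.
move=> [a fE]; exists (fun i j => c * a i j) => x.
rewrite fE mulr_sumr; apply: eq_bigr => i _.
by rewrite mulr_sumr; apply: eq_bigr => j _; rewrite !mulrA.
Qed.

Lemma cont_pw_poly_lincomb k n (c : 'I_n -> R) (F : 'I_n -> pt -> R) :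
  (forall i, cont_pw_poly T k (F i)) ->
  cont_pw_poly T k (fun x => \sum_i c i * F i x).
Proof.
move=> pF; elim: (index_enum _) => [|i r IH].
  under eq_fun do rewrite big_nil.
  split=> [x|s _]; first exact: cvg_cst.
  by exists (fun=> 0) => //; exact: poly_deg_le_cst.
under eq_fun do rewrite big_cons.
have [[ci pi] [cr pr]] := (pF i, IH); split=> [x|s sT].
  apply: (@cvgD _ R^o); last exact: cr.
  by apply: cvgM; [exact: cvg_cst|exact: ci].
have [[p dp fp] [q dq fq]] := (pi s sT, pr s sT).
exists (fun x => c i * p x + q x) => [|x sx]; last by rewrite fp// fq.
by apply: poly_deg_leD => //; exact: poly_deg_leZ.
Qed.

(** The linear part commutes with the combination, and the constant term is reproduced because the
    weights sum to 1. *)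
Lemma poly_deg_le1_convex n (a : 'I_n -> pt) (s : {set 'I_n}) (c : 'I_n -> R)
    (p : pt -> R) : poly_deg_le 1 p -> \sum_(i in s) c i = 1 ->
  p (\sum_(i in s) c i *: a i) = \sum_(i in s) c i * p (a i).
Proof.
move=> [b pE] c1.
have {}pE x : p x = b 0%N 0%N + b 0%N 1%N * x.2 + b 1%N 0%N * x.1.
  rewrite pE big_ord_recl big_ord1 subn0 big_ord_recl big_ord1.
  rewrite (_ : 2 - _ = 1)%N// big_ord1 /= /bump /=.
  by rewrite !expr0 !expr1 !mulr1.
have fstE : (\sum_(i in s) c i *: a i).1 = \sum_(i in s) c i * (a i).1.
  exact: (@big_morph _ _ fst).
have sndE : (\sum_(i in s) c i *: a i).2 = \sum_(i in s) c i * (a i).2.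
  exact: (@big_morph _ _ snd).
rewrite pE fstE sndE -[b 0%N 0%N]mulr1 -c1 !mulr_sumr -!big_split.
by apply: eq_bigr => i _; rewrite /= pE; ring.
Qed.

Lemma simplex_vert n (a : 'I_n -> pt) (s : {set 'I_n}) i : i \in s ->
  simplex a s (a i).
Proof.
move=> si; exists (fun j => (j == i)%:R); split=> [j _||].
- exact: ler0n.
- rewrite (bigD1 i)//= eqxx big1 ?addr0// => j /andP[_ /negPf ->//].
- rewrite (bigD1 i)//= eqxx scale1r big1 ?addr0// => j /andP[_ /negPf ->].
  by rewrite scale0r.
Qed.

Lemma vert_closure i : closure (dom D) (vert T i).
Proof.
by have [s sT si] := tri_vert i; apply: cell_closure sT _; exact: simplex_vert.
Qed.

(** Carries information at a vertex, which may lie on the boundary, to a nonempty open subset of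
    [D]. *)
Lemma closure_open_value (f : pt -> R) (x : pt) (O : set R) :
  {within closure (dom D), continuous f} -> closure (dom D) x ->
  nbhs (f x) O ->
  exists U, [/\ open U, U !=set0, U `<=` dom D & U `<=` f @^-1` O].
Proof.
move=> /subspace_continuousP cf cx fO.
have /= := cf x cx _ fO; rewrite /within/= nbhsE => -[V [oV Vx] VO].
exists (V `&` dom D); split.
- by apply: openI => //; exact: dom_open.
- by rewrite setIC; apply: cx; exact: open_nbhs_nbhs.
- exact: subIsetr.
- by move=> y [Vy Dy]; apply: VO => //; exact: subset_closure.
Qed.

Variable vphi : 'I_(nvert T) -> pt -> R.
Hypothesis vphi_nodal : P1_nodal_basis vphi.

Let vphi_poly i : cont_pw_poly T 1 (vphi i).
Proof. by have [] := vphi_nodal i. Qed.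

Let vphi_bounded i : bounded_on_D (vphi i).
Proof. exact: cont_pw_poly_ess_bounded (vphi_poly i). Qed.

(** On each cell the sum is affine and takes the value 1 at the vertices. *)
Lemma nodal_basis_partition x : dom D x -> \sum_i vphi i x = 1.
Proof.
move=> /(dom_cell T)[s sT sx].
have [_ /(_ s sT)[p dp fp]] : cont_pw_poly T 1 (fun x => \sum_i 1 * vphi i x).
  exact: cont_pw_poly_lincomb.
have -> : \sum_i vphi i x = p x.
  by rewrite -fp//; apply: eq_bigr => i _; rewrite mul1r.
case: (sx) => c [_ c1 ->]; rewrite poly_deg_le1_convex// -[RHS]c1.
apply: eq_bigr => j js; rewrite -fp; last exact: simplex_vert.
rewrite (bigD1 j)//= (vphi_nodal j).2 eqxx big1 ?addr0 ?mulr1// => i ij.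
by rewrite (vphi_nodal i).2 (negPf ij) mulr0.
Qed.

(** Near its own vertex [vphi i] exceeds 1/2, so its square exceeds 1/4 on an open set of positive
    area. *)
Lemma mass_mx_diag_gt0 i : 0 < mass_mx D vphi i i.
Proof.
have mD := dom_measurable D; have DT := dom_area_lty D.
have [|U [oU U0 UD Uf]] := @closure_open_value (vphi i) (vert T i)
    [set y | 2^-1 < y] (vphi_poly i).1 (@vert_closure i).
  apply: open_nbhs_nbhs; split; first exact: open_gt.
  by rewrite /= (vphi_nodal i).2 eqxx invf_lt1 ?ltr1n.
have mU : measurable (U : set mpt) by exact: open_measurable_plane.
have UT : (area U < +oo)%E.
  by apply: le_lt_trans DT; apply: le_measure; rewrite ?inE.
have bU : bounded_on_D (\1_U : mpt -> R).
  apply: (@ess_bounded_le _ mpt R area _ _ 1); first exact: measurable_indic.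
  by move=> x _; rewrite indicE ger0_norm// lern1 leq_b1.
rewrite mxE; apply: (@lt_le_trans _ _
    (\int[area]_(x in dom D) (4^-1 * \1_U x))).
  rewrite ess_bounded_RintegralZ// mulr_gt0//.
  rewrite /Rintegral integral_indic// setIidl//.
  by rewrite fine_gt0// UT area_open_gt0.
apply: le_Rintegral => //.
- apply: ess_bounded_integrable => //; apply: ess_boundedM => //.
  exact: ess_bounded_cst.
- by apply: ess_bounded_integrable => //; exact: ess_boundedM.
move=> x Dx; rewrite indicE; have [Ux|_] := boolP (x \in U).
  have : 2^-1 < vphi i x by apply: Uf; rewrite inE in Ux.
  by rewrite /=; nra.
by rewrite mulr0 -expr2 sqr_ge0.
Qed.

Variables (n : nat) (phi : 'I_n -> pt -> pt).
Hypothesis phi_basis : V0h_basis T phi.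

(** If the pressure [qh] with coefficients [q] were nonzero, it would compete in the infimum with
    all quotients equal to 0, making the inf-sup constant nonpositive. *)
Lemma infsup_ker_eq0 (q : 'cV[R]_(nvert T)) : (0 < infsup T)%E ->
  (divergence_mx T vphi phi)^T *m q = 0 ->
  (const_mx 1 : 'rV[R]_(nvert T)) *m mass_mx D vphi *m q = 0 -> q = 0.
Proof.
move=> infsup_gt0 Bq Mq; have mD := dom_measurable D; have DT := dom_area_lty D.
pose qh (x : pt) := \sum_i q i 0 * vphi i x.
have qh_poly : cont_pw_poly T 1 qh by exact: cont_pw_poly_lincomb.
have bqi i : bounded_on_D (fun x => q i 0 * vphi i x).
  by apply: ess_boundedM (vphi_bounded i); exact: ess_bounded_cst.
(* As the hat functions sum to 1, the row of ones times the mass matrix lists their integrals. *)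
have qh_mean : intD D qh = 0.
  move/matrixP: Mq => /(_ 0 0); rewrite [RHS]mxE => <-.
  rewrite /intD ess_bounded_Rintegral_sum// mxE; apply: eq_bigr => j _.
  rewrite ess_bounded_RintegralZ// mulrC; congr (_ * _).
  rewrite mxE (eq_bigr (fun i => intD D (fun x => vphi i x * vphi j x))).
    rewrite /intD -ess_bounded_Rintegral_sum//; last first.
      by move=> i; exact: ess_boundedM.
    apply: eq_Rintegral => x; rewrite inE => Dx.
    by rewrite -mulr_suml nodal_basis_partition// mul1r.
  by move=> i _; rewrite !mxE mul1r.
have qh_div v : V0h T v -> intD D (fun x => qh x * divg T v x) = 0.
  move=> /phi_basis.2[c [vE _]].
  have divE x : divg T v x = \sum_j c 0 j * divg T (phi j) x.
    rewrite /divg !grad_pw_derive /=.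
    rewrite (pw_derive_sum (k := 2) (c := c 0) (F := fun j y => (phi j y).1)).
    - rewrite (pw_derive_sum (k := 2) (c := c 0) (F := fun j y => (phi j y).2)).
      + by rewrite -big_split; apply: eq_bigr => j _; rewrite !grad_pw_derive mulrDr.
      + by move=> j; have [] := phi_basis.1 j.
      + by move=> y /vE ->; exact: (@big_morph _ _ snd).
    - by move=> j; have [] := phi_basis.1 j.
    - by move=> y /vE ->; exact: (@big_morph _ _ fst).
  have bd i j : bounded_on_D (fun x => vphi i x * divg T (phi j) x).
    by apply: ess_boundedM => //; exact: divg_ess_bounded phi_basis.1 j.
  have bcd i j : bounded_on_D (fun x =>
      c 0 j * q i 0 * (vphi i x * divg T (phi j) x)).
    by apply: ess_boundedM (bd i j); exact: ess_bounded_cst.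
  rewrite /intD (_ : (fun x => _) = fun x => \sum_j \sum_i
      c 0 j * q i 0 * (vphi i x * divg T (phi j) x)); last first.
    apply/funext => x; rewrite divE mulr_sumr; apply: eq_bigr => j _.
    by rewrite mulr_suml; apply: eq_bigr => i _; ring.
  rewrite ess_bounded_Rintegral_sum//; last by move=> j; exact: ess_bounded_sum.
  apply: big1 => j _; rewrite ess_bounded_Rintegral_sum//.
  (* The minus sign undoes the one in [divergence_mx]. *)
  rewrite (eq_bigr (fun i => - c 0 j * ((divergence_mx T vphi phi)^T j i * q i 0))).
    rewrite -mulr_sumr; move/matrixP: Bq => /(_ j 0); rewrite mxE => ->.
    by rewrite mxE mulr0.
  by move=> i _; rewrite ess_bounded_RintegralZ// !mxE /intD; ring.
have qh0 x : dom D x -> qh x = 0.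
  move=> Dx; apply/eqP/negPn/negP => qx0; move: infsup_gt0; apply/negP.
  rewrite -leNgt; apply: le_trans (ereal_inf_lbound _) _.
    by exists qh => //; split; [split|exists x].
  apply: ub_ereal_sup => _ [v [Vv _] <-].
  by rewrite qh_div// normr0 mul0r.
apply/matrixP => j k; rewrite ord1 [RHS]mxE; apply/eqP/negPn/negP => qj0.
have qjE : qh (vert T j) = q j 0.
  rewrite /qh (bigD1 j)//= (vphi_nodal j).2 eqxx mulr1 big1 ?addr0// => i ij.
  by rewrite (vphi_nodal i).2 (negPf ij) mulr0.
(* A nonzero value at the vertex would persist, by continuity, at some point of [D], where [qh]
   vanishes. *)
have [|U [oU [x Ux] UD Uf]] := @closure_open_value qh (vert T j)
    [set y | y != 0] qh_poly.1 (@vert_closure j).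
  by apply: open_nbhs_nbhs; split; [exact: open_neq|rewrite /= qjE].
by have := Uf _ Ux; rewrite /preimage/= qh0 ?eqxx//; exact: UD.
Qed.

End PressureSpace.

(** * Kronecker products and Galerkin forms *)

Section TensorBlocks.
Context {R : realType}.
Local Notation form A u := ((u^T *m A *m u) 0 0).

(** The spatial coefficients attached to the [i]-th stochastic basis function. *)
Definition tens_block Q n (v : 'cV[R]_(Q * n)) (i : 'I_Q) : 'cV[R]_n :=
  \col_j v (mxtens_index (i, j)) 0.

Lemma tens_block_eq0 Q n (v : 'cV[R]_(Q * n)) :
  (forall i, tens_block v i = 0) -> v = 0.
Proof.
move=> v0; apply/matrixP => k l; rewrite ord1 [RHS]mxE.
case: (mxtens_indexP k) => i j.
by have /matrixP/(_ j 0) := v0 i; rewrite !mxE.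
Qed.

Lemma big_mxtens (V : nmodType) Q n (F : 'I_(Q * n) -> V) :
  \sum_k F k = \sum_i \sum_j F (mxtens_index (i, j)).
Proof.
rewrite pair_big (reindex (@mxtens_index Q n)) /=; last first.
  by apply: onW_bij; exact: Bijective (@mxtens_indexK Q n) (@mxtens_unindexK Q n).
by apply: eq_bigr => -[i j].
Qed.

Lemma tens_block_mul1 Q p n (B : 'M[R]_(p, n)) (v : 'cV[R]_(Q * n)) i :
  tens_block ((1%:M *t B) *m v) i = B *m tens_block v i.
Proof.
apply/matrixP => j k; rewrite ord1 !mxE big_mxtens (bigD1 i)//= [X in _ + X]big1.
  by rewrite addr0; apply: eq_bigr => l _; rewrite tensmxE !mxE eqxx mul1r.
move=> i' /negPf i'i; rewrite big1// => l _.
by rewrite tensmxE !mxE eq_sym i'i !mul0r.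
Qed.

Lemma tens_form Q n (G : 'M[R]_Q) (A : 'M[R]_n) (v : 'cV[R]_(Q * n)) :
  form (G *t A) v = \sum_i \sum_j
    G i j * (((tens_block v i)^T *m A *m tens_block v j) 0 0).
Proof.
rewrite mxE big_mxtens exchange_big.
under eq_bigr do under eq_bigr do rewrite mxE big_mxtens mulr_suml.
under eq_bigr do rewrite exchange_big.
rewrite exchange_big /=; apply: eq_bigr => i _.
rewrite exchange_big /=; apply: eq_bigr => j _.
rewrite mxE mulr_sumr; apply: eq_bigr => l _.
rewrite mxE mulr_suml mulr_sumr mulr_suml; apply: eq_bigr => k _.
by rewrite tensmxE !mxE; ring.
Qed.

Lemma tens1_form Q n (A : 'M[R]_n) (v : 'cV[R]_(Q * n)) :
  form (1%:M *t A) v = \sum_i form A (tens_block v i).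
Proof.
rewrite tens_form; apply: eq_bigr => i _; rewrite (bigD1 i)//= big1.
  by rewrite addr0 mxE eqxx mul1r.
by move=> j ji; rewrite mxE eq_sym (negPf ji) mul0r.
Qed.

(** The form is the sum of the forms of the blocks; if it vanishes, so does every block. *)
Lemma tens1_sym_posdef Q n (A : 'M[R]_n) : sym_posdef A ->
  sym_posdef ((1%:M : 'M[R]_Q) *t A).
Proof.
move=> pA; split; first by rewrite trmx_tens trmx1 pA.1.
move=> v v0; rewrite lt_neqAle eq_sym; apply/andP; split; last first.
  by rewrite tens1_form sumr_ge0// => i _; exact: sym_posdef_ge0.
apply: contra_neq v0; rewrite tens1_form => /eqP.
rewrite psumr_eq0 => [/allP s0|i _]; last exact: sym_posdef_ge0.
apply: tens_block_eq0 => i; apply: (sym_posdef_eq0 pA).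
by have /eqP -> := s0 i (mem_index_enum i).
Qed.

End TensorBlocks.

Section GalerkinForm.
Context {R : realType} d (S : measurableType d).
Variable mu : {measure set S -> \bar R}.
Hypothesis mu_fin : (mu setT < +oo)%E.
Variables (Q n : nat) (psi : 'I_Q -> S -> R).
Hypothesis psi_bounded : forall i, ess_bounded mu setT (psi i).
Local Notation form A u := ((u^T *m A *m u) 0 0).

(** The realisation at [y] of the random vector expanded in [psi] with the blocks of [v] as
    coefficients. *)
Let field (v : 'cV[R]_(Q * n)) (y : S) : 'cV[R]_n :=
  \sum_i psi i y *: tens_block v i.

Let field_formE (A : 'M[R]_n) v y : form A (field v y) = \sum_i \sum_j
  ((tens_block v i)^T *m A *m tens_block v j) 0 0 * (psi i y * psi j y).
Proof.
have -> : (field v y)^T = \sum_i psi i y *: (tens_block v i)^T.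
  apply/matrixP => k l; rewrite mxE !summxE.
  by apply: eq_bigr => i _; rewrite !mxE.
rewrite !mulmx_suml summxE; apply: eq_bigr => i _.
rewrite /field mulmx_sumr summxE; apply: eq_bigr => j _.
by rewrite -scalemxAr -!scalemxAl scalerA mxE mulrC [psi j y * _]mulrC.
Qed.

Let field_form_bounded A v : ess_bounded mu setT (fun y => form A (field v y)).
Proof.
under eq_fun do rewrite field_formE.
apply: ess_bounded_sum => i; apply: ess_bounded_sum => j.
apply: ess_boundedM; first exact: ess_bounded_cst.
exact: ess_boundedM.
Qed.

(* For random coefficients [v], the Kronecker form is the expectation of the
   form of [A] at the random vector with these coefficients. *)
Lemma galerkin_form (w : S -> R) (A : 'M[R]_n) (v : 'cV[R]_(Q * n)) :
  ess_bounded mu setT w ->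
  form ((\matrix_(i, j) \int[mu]_y (w y * psi i y * psi j y)) *t A) v =
  \int[mu]_y (w y * form A (field v y)).
Proof.
move=> bw; have bww i j : ess_bounded mu setT (fun y => w y * psi i y * psi j y).
  by do 2!apply: ess_boundedM => //.
have bwc i j : ess_bounded mu setT (fun y =>
    ((tens_block v i)^T *m A *m tens_block v j) 0 0 *
      (w y * psi i y * psi j y)).
  by apply: ess_boundedM (bww i j); exact: ess_bounded_cst.
rewrite (_ : (fun y => w y * _) = fun y => \sum_i \sum_j
    ((tens_block v i)^T *m A *m tens_block v j) 0 0 *
      (w y * psi i y * psi j y)); last first.
  apply/funext => y; rewrite field_formE mulr_sumr; apply: eq_bigr => i _.
  by rewrite mulr_sumr; apply: eq_bigr => j _; rewrite mulrCA !mulrA.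
rewrite tens_form ess_bounded_Rintegral_sum//; last first.
  by move=> i; exact: ess_bounded_sum.
apply: eq_bigr => i _; rewrite ess_bounded_Rintegral_sum//.
by apply: eq_bigr => j _; rewrite ess_bounded_RintegralZ// [X in X * _]mxE mulrC.
Qed.

Hypothesis psi_orthonormal :
  forall i j, \int[mu]_y (psi i y * psi j y) = (i == j)%:R.

(** The bound holds pointwise for the forms at [field v y], almost surely in [y], and is then
    integrated. *)
Lemma galerkin_form_le (w : S -> R) (A A' : 'M[R]_n) (v : 'cV[R]_(Q * n))
    (r kappa : R) :
  ess_bounded mu setT w -> {ae mu, forall y, setT y -> `|w y| <= r} ->
  (forall u : 'cV[R]_n, `|form A' u| <= kappa * form A u) ->
  `|form ((\matrix_(i, j) \int[mu]_y (w y * psi i y * psi j y)) *t A') v| <=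
    r * kappa * form ((1%:M : 'M[R]_Q) *t A) v.
Proof.
move=> bw wr AA; rewrite galerkin_form//.
(* By orthonormality the identity is the Galerkin matrix of the weight 1, so [galerkin_form] also
   covers the right-hand side. *)
have -> : (1%:M : 'M[R]_Q) = \matrix_(i, j) \int[mu]_y (1 * psi i y * psi j y).
  apply/matrixP => i j; rewrite !mxE -psi_orthonormal.
  by apply: eq_Rintegral => y _; rewrite mul1r.
rewrite galerkin_form; last exact: ess_bounded_cst.
under [X in _ <= _ * X]eq_Rintegral do rewrite mul1r.
have bA := field_form_bounded A v; have bA' := field_form_bounded A' v.
have bwA := ess_boundedM bw bA'.
have bc c : ess_bounded mu setT (fun y => c * form A (field v y)).
  by apply: ess_boundedM bA; exact: ess_bounded_cst.
have le_ae y : (setT y -> `|w y| <= r) ->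
    `|w y * form A' (field v y)| <= r * kappa * form A (field v y).
  by move=> /(_ I) wyr; rewrite normrM -mulrA ler_pM.
rewrite ler_norml -mulNr -!ess_bounded_RintegralZ//; apply/andP; split.
  apply: ae_le_Rintegral => //; apply: ae_mono wr => y /le_ae + _.
  by rewrite ler_norml -mulNr => /andP[].
apply: ae_le_Rintegral => //; apply: ae_mono wr => y /le_ae + _.
by rewrite ler_norml => /andP[].
Qed.

End GalerkinForm.

(** * The uniform cube and the Legendre basis *)

Section UniformCube.
Context {R : realType}.
Local Notation RM := (measurableTypeR R).

Definition cube M : set (M.-tuple RM) :=
  [set y | forall m, `|tnth y m| <= @sqrt3 R].
Arguments cube : clear implicits.

Lemma cons_pair_cube M :
  @cons_pair R M @^-1` cube M.+1 = `[- sqrt3, sqrt3]%classic `*` cube M.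
Proof.
apply/seteqP; split=> [[x y] /= xy|[x y] [/=]].
  split=> [|m] /=; first by rewrite in_itv/= -ler_norml; exact: (xy ord0).
  by have := xy (lift ord0 m); rewrite tnthS.
rewrite in_itv/= -ler_norml => xs ys m.
by case: (unliftP ord0 m) => [j ->|->]; [rewrite tnthS; exact: ys|].
Qed.

Lemma measurable_cube M : measurable (cube M).
Proof.
rewrite (_ : cube M = \bigcap_(m in [set: 'I_M])
    ((@tnth M RM ^~ m) @^-1` `[- sqrt3, sqrt3]%classic)).
  apply: fin_bigcap_measurable => // m _; rewrite -[X in measurable X]setTI.
  by apply: measurable_tnth => //; exact: measurable_itv.
apply/seteqP; split=> [y ys m _|y ys m].
  by rewrite /= in_itv/= -ler_norml.
by have := ys m I; rewrite /= in_itv/= -ler_norml.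
Qed.

Lemma uniform1_itv : @uniform1 R `[- sqrt3, sqrt3]%classic = 1%E.
Proof. exact: (integral_uniform_pdf1 lt_Nsqrt3_sqrt3). Qed.

(** By induction: [cons_pair] pulls the cube back to an interval times a smaller cube, both of full
    mass. *)
Lemma uniform_cube1 M : uniform_cube M (cube M) = 1%E.
Proof.
elim: M => [|M IH].
  by rewrite /= diracE mem_set// => -[].
rewrite /= /distribution /pushforward cons_pair_cube product_measure1E//.
- rewrite [X in (X * _)%E]uniform1_itv mul1e; exact: IH.
- exact: measurable_cube.
Qed.

Lemma ae_cube (M : nat) : {ae @uniform_cube R M, forall y, cube M y}.
Proof.
exists (~` cube M); split => //; first by apply: measurableC; exact: measurable_cube.
rewrite probability_setC; last exact: measurable_cube.
by rewrite uniform_cube1 subee.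
Qed.

Lemma tnth_ess_bounded M m :
  ess_bounded (@uniform_cube R M) setT (fun y => tnth y m).
Proof.
split; first exact: measurable_tnth.
by exists sqrt3; apply: ae_mono (@ae_cube M) => y ys _; exact: ys.
Qed.

Lemma horner_ess_bounded d (T : measurableType d)
    (mu : {measure set T -> \bar R}) (f : T -> R) (p : {poly R}) :
  ess_bounded mu setT f -> ess_bounded mu setT (fun x => p.[f x]).
Proof.
move=> bf; elim/poly_ind: p => [|p c IH].
  by under eq_fun do rewrite horner0; exact: ess_bounded_cst.
under eq_fun do rewrite hornerMXaddC.
apply: ess_boundedD; last exact: ess_bounded_cst.
exact: ess_boundedM.
Qed.

Lemma id_ess_bounded : ess_bounded (@uniform1 R) setT (fun x : RM => x : R).
Proof.
split; first exact: measurable_id.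
exists sqrt3; exists (~` `[- sqrt3, sqrt3]%classic); split.
- by apply: measurableC; exact: measurable_itv.
- apply: eq_trans (probability_setC (@uniform1 R) (measurable_itv _)) _.
  by rewrite [X in (_ - X)%E]uniform1_itv subee.
- move=> x /= /not_implyP[_] /negP; rewrite -ltNge => xs.
  by rewrite in_itv/= -ler_norml leNgt xs.
Qed.

(** The preimage of a null set of the law of [X] is null by definition of the pushforward. *)
Lemma ess_bounded_distribution d d' (T : measurableType d)
    (T' : measurableType d') (P : probability T R) (X : {RV P >-> T'})
    (f : T' -> R) :
  ess_bounded (distribution P X) setT f -> ess_bounded P setT (f \o X).
Proof.
move=> [mf [C [N [mN N0 CN]]]]; split; first exact: measurableT_comp.
exists C, (X @^-1` N); split=> //.
  by rewrite -[X in measurable X]setTI; exact: measurable_funPT.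
by move=> x /= nC; apply: CN.
Qed.

Lemma Rintegral_distribution d d' (T : measurableType d)
    (T' : measurableType d') (P : probability T R) (X : {RV P >-> T'})
    (f : T' -> R) : ess_bounded (distribution P X) setT f ->
  \int[distribution P X]_y f y = \int[P]_x f (X x).
Proof.
move=> bf; have PT : (P setT < +oo)%E by rewrite probability_setT ltry.
rewrite /Rintegral integral_distribution//.
  by apply/measurable_EFinP; case: bf.
apply: ess_bounded_integrable => //.
exact: ess_bounded_distribution.
Qed.

Lemma Rintegral_prod_separated d1 d2 (T1 : measurableType d1)
    (T2 : measurableType d2) (P1 : probability T1 R) (P2 : probability T2 R)
    (f : T1 -> R) (g : T2 -> R) :
  ess_bounded P1 setT f -> ess_bounded P2 setT g ->
  ess_bounded (P1 \x P2)%E setT (fun z => f z.1 * g z.2) ->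
  \int[(P1 \x P2)%E]_z (f z.1 * g z.2) = \int[P1]_x f x * \int[P2]_y g y.
Proof.
move=> bf bg bfg.
have P1y : (P1 setT < +oo)%E by rewrite probability_setT ltry.
have P2y : (P2 setT < +oo)%E by rewrite probability_setT ltry.
have P12y : ((P1 \x P2)%E (setT `*` setT) < +oo)%E.
  by rewrite product_measure1E// lte_mul_pinfty// fin_num_measure.
rewrite setXTT in P12y.
rewrite /Rintegral -integral12_prod_meas1; last first.
  by apply: ess_bounded_integrable bfg => //; exact: P12y.
rewrite -/(Rintegral P2 setT g) -RintegralZr//; last first.
  exact: ess_bounded_integrable.
congr fine; apply: eq_integral => x _; rewrite /fubini_F /=.
rewrite -ess_bounded_RintegralZ// /Rintegral fineK//.
apply: integrable_fin_num => //; apply: ess_bounded_integrable => //.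
by apply: ess_boundedM => //; exact: ess_bounded_cst.
Qed.

Lemma Rintegral_uniform_cube_prod M (f : 'I_M -> {poly R}) :
  \int[uniform_cube M]_y (\prod_m (f m).[tnth y m]) =
  \prod_m \int[uniform1]_x (f m).[x].
Proof.
elim: M f => [|M IH] f.
  rewrite big_ord0; under eq_Rintegral do rewrite big_ord0.
  rewrite Rintegral_cst// mul1r.
  exact: (congr1 fine (probability_setT (@uniform_cube R 0))).
(* Serves twice: for the change of variables along [cons_pair] and, pulled back, as the
   integrability on the product that Fubini requires. *)
have bF : ess_bounded (uniform_cube M.+1) setT
    (fun y => \prod_m (f m).[tnth y m]).
  by apply: ess_bounded_prod => m; exact/horner_ess_bounded/tnth_ess_bounded.
rewrite /= Rintegral_distribution//.
have consE (z : RM * M.-tuple RM) : \prod_m (f m).[tnth (cons_pair z) m] =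
    (f ord0).[z.1] * \prod_m (f (lift ord0 m)).[tnth z.2 m].
  by rewrite big_ord_recl; congr (_ * _); apply: eq_bigr => m _; rewrite tnthS.
under eq_Rintegral do rewrite consE.
apply: etrans (@Rintegral_prod_separated _ _ _ _ (@uniform1 R) (uniform_cube M)
  (fun x => (f ord0).[x]) (fun y => \prod_m (f (lift ord0 m)).[tnth y m])
  _ _ _) _; last by rewrite IH big_ord_recl.
- exact: horner_ess_bounded id_ess_bounded.
- by apply: ess_bounded_prod => m; exact/horner_ess_bounded/tnth_ess_bounded.
- rewrite (_ : (fun z => _) = (fun y => \prod_m (f m).[tnth y m]) \o @cons_pair R M).
    exact: ess_bounded_distribution.
  by apply/funext => z /=; rewrite -consE.
Qed.

Section LegendreBasis.
Variables (p : nat -> {poly R}) (M Q : nat) (alpha : 'I_Q -> {ffun 'I_M -> nat}).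
Hypotheses (p_legendre : legendre_orthonormal p) (alpha_inj : injective alpha).

Lemma legendre_prod_ess_bounded b :
  ess_bounded (uniform_cube M) setT (legendre_prod p b).
Proof.
by apply: ess_bounded_prod => m; exact/horner_ess_bounded/tnth_ess_bounded.
Qed.

(** The integral factors over the coordinates; distinct multi-indices differ in some coordinate,
    whose factor is 0. *)
Lemma legendre_prod_orthonormal i j :
  \int[uniform_cube M]_y
    (legendre_prod p (alpha i) y * legendre_prod p (alpha j) y) = (i == j)%:R.
Proof.
rewrite (_ : (fun y => _) =
    fun y => \prod_m (p (alpha i m) * p (alpha j m)).[tnth y m]); last first.
  apply/funext => y; rewrite /legendre_prod -big_split.
  by apply: eq_bigr => m _; rewrite hornerM.
rewrite Rintegral_uniform_cube_prod.
rewrite (eq_bigr (fun m => (alpha i m == alpha j m)%:R)); last first.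
  move=> m _; rewrite -p_legendre.2.
  by apply: eq_Rintegral => x _; rewrite hornerM.
have [->|ij] := eqVneq i j; first by rewrite big1// => m _; rewrite eqxx.
have [m aij] : exists m, alpha i m != alpha j m.
  apply/existsP; rewrite -negb_forall; apply: contra ij => /forallP aij.
  by apply/eqP/alpha_inj/ffunP => m; exact/eqP.
by rewrite (bigD1 m)//= (negPf aij) mul0r.
Qed.

End LegendreBasis.
End UniformCube.

(** * Coercivity of the stochastic Galerkin system *)

Section ChiSeries.
Context {R : realType} (D : domain R) (f : nat -> R * R -> R).
Hypothesis f_Linfty : forall m, Linfty D (f m).
Hypothesis chi_lty : (\sum_(0 <= m <oo) Linfty_norm D (f m) < +oo)%E.

Lemma sum_Linfty_norm_le M :
  \sum_(m < M) fine (Linfty_norm D (f m)) <=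
  fine (\sum_(0 <= m <oo) Linfty_norm D (f m))%E.
Proof.
have chi_fin : (\sum_(0 <= m <oo) Linfty_norm D (f m))%E \is a fin_num.
  rewrite ge0_fin_numE//; apply: nneseries_ge0 => m _ _.
  exact: Linfty_norm_ge0.
rewrite -lee_fin fineK// -sumEFin.
rewrite (eq_bigr (fun m : 'I_M => Linfty_norm D (f m))); last first.
  by move=> m _; rewrite fineK ?Linfty_norm_fin.
rewrite -(big_mkord xpredT (fun m => Linfty_norm D (f m))).
by apply: nneseries_lim_ge => m _ _; exact: Linfty_norm_ge0.
Qed.

End ChiSeries.

Section Preconditioner.
Context {R : realType} (n : nat) (A K : 'M[R]_n) (delta : R).
Local Notation form A u := ((u^T *m A *m u) 0 0).
Hypotheses (A_ge0 : forall u : 'cV[R]_n, 0 <= form A u) (delta_gt0 : 0 < delta)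
  (K_equiv : forall u : 'cV[R]_n, u != 0 -> delta <= form A u / form K u).

(** A nonpositive denominator, including 0 whose inverse is 0, would make the quotient nonpositive,
    hence smaller than [delta]. *)
Lemma spectral_equiv_gt0 (u : 'cV[R]_n) : u != 0 -> 0 < form K u.
Proof.
move=> /K_equiv/(lt_le_trans delta_gt0); apply: contraTT; rewrite -!leNgt => Ku.
by rewrite mulr_ge0_le0// invr_le0.
Qed.

Lemma spectral_equiv_le (u : 'cV[R]_n) : delta * form K u <= form A u.
Proof.
have [->|u0] := eqVneq u 0; first by rewrite !mulmx0 mxE mulr0.
by rewrite -ler_pdivlMr ?spectral_equiv_gt0// K_equiv.
Qed.

End Preconditioner.

Theorem lemma8p1 (R : realType) (D : domain R)
  (* viscosity data; [lam m] and [nu m] are the paper's with index m.+1 *)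
  (nu0 : R * R -> R) (sigma : R) (lam : nat -> R) (nu : nat -> R * R -> R)
  (nu0_Linfty : Linfty D nu0)
  (nu0_inf_gt0 : (0 < ess_inf_on D nu0)%E)
  (nu0_sup_lty : (ess_sup_on D nu0 < +oo)%E)
  (sigma_gt0 : 0 < sigma)
  (lam_ge0 : forall m, 0 <= lam m)
  (nu_Linfty : forall m, Linfty D (fun x => Num.sqrt (lam m) * nu m x)) :
  let nu0_inf : R := fine (ess_inf_on D nu0) in
  let chi_ (m : nat) : \bar R :=
    Linfty_norm D (fun x => Num.sqrt (lam m) * nu m x) in
  let chi : R := fine (\sum_(0 <= m <oo) chi_ m)%E in
  forall
  (chi_lty : (\sum_(0 <= m <oo) chi_ m < +oo)%E)
  (nu0_inf_gt : Num.sqrt 3 * sigma * chi < nu0_inf)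
  (delta Delta : R) (delta_gt0 : 0 < delta) (Delta_gt0 : 0 < Delta)
  (* Taylor-Hood finite elements *)
  (T : triangulation D) (Nu : nat)
  (phi : 'I_Nu -> R * R -> R * R) (phi_basis : V0h_basis T phi)
  (vphi : 'I_(nvert T) -> R * R -> R) (vphi_nodal : P1_nodal_basis vphi)
  (infsup_gt0 : (0 < infsup T)%E),
  let Np : nat := nvert T in
  let A : 'M[R]_Nu := stiffness T phi (fun=> 1) in
  let A0 : 'M[R]_Nu := stiffness T phi nu0 in
  let A_ (m : nat) : 'M[R]_Nu :=
    stiffness T phi (fun x => sigma * Num.sqrt (lam m) * nu m x) in
  let B : 'M[R]_(Np, Nu) := divergence_mx T vphi phi in
  let Mp : 'M[R]_Np := mass_mx D vphi in
  let Dp : 'M[R]_Np := diag_mx (\row_i Mp i i) in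
  forall
  (* multigrid preconditioner *)
  (Amg : 'M[R]_Nu) (Amg_sym : Amg^T = Amg)
  (Amg_equiv : forall v : 'cV[R]_Nu, v != 0 ->
     delta <= (v^T *m A *m v) 0 0 / (v^T *m Amg *m v) 0 0 <= Delta)
  (* stochastic Galerkin discretisation *)
  (M k : nat) (p : nat -> {poly R}) (p_legendre : legendre_orthonormal p)
  (alpha : 'I_'C(M + k, k) -> {ffun 'I_M -> nat})
  (alpha_enum : enum_multi_index k alpha),
  let Q : nat := 'C(M + k, k) in
  let G : 'I_M -> 'M[R]_Q := sg_mx (fun i => legendre_prod p (alpha i)) in
  let calA : 'M[R]_(Q * Nu) :=
    (1%:M : 'M[R]_Q) *t A0 + \sum_(m < M) G m *t A_ m in
  let calB : 'M[R]_(Q * Np, Q * Nu) := (1%:M : 'M[R]_Q) *t B in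
  let calAmg : 'M[R]_(Q * Nu) := (1%:M : 'M[R]_Q) *t Amg in
  let calSp : 'M[R]_(Q * Np) := (1%:M : 'M[R]_Q) *t Dp in
  forall (a_delta : R) (a_delta_gt0 : 0 < a_delta) (a_delta_lt1 : a_delta < 1),
  let delta_hat : R := (nu0_inf - Num.sqrt 3 * sigma * chi) * delta in
  let a : R := a_delta * delta_hat in
  let C := block_mx calA calB^T calB 0 in
  let P2 := block_mx (a *: calAmg) 0 calB (- calSp) in
  let H := block_mx (calA - (a_delta * delta_hat) *: calAmg) 0 0 calSp in
  sym_posdef H /\
  (* [invmx] is the inverse only on invertible matrices *)
  P2 \in unitmx /\
  H *m (invmx P2 *m C) = (invmx P2 *m C)^T *m H /\
  (forall (v : 'cV[R]_(Q * Nu)) (q : 'cV[R]_(Q * Np)),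
     let w := col_mx v q in
     w != 0 ->
     ((1%:M : 'M[R]_Q) *t ((const_mx 1 : 'rV[R]_Np) *m Mp)) *m q = 0 ->
     0 < (w^T *m (H *m (invmx P2 *m C)) *m w) 0 0).
Proof.
move=> nu0_inf chi_ chi chi_lty nu0_inf_gt delta Delta delta_gt0 _ T Nu phi
  phi_basis vphi vphi_nodal infsup_gt0 Np A A0 A_ B Mp Dp Amg Amg_sym Amg_equiv
  M k p p_legendre alpha alpha_enum Q G calA calB calAmg calSp a_delta
  a_delta_gt0 a_delta_lt1 delta_hat a C P2 H.
set sqrt3 := Num.sqrt 3 in nu0_inf_gt delta_hat a H P2 *.
pose form n (K : 'M[R]_n) (u : 'cV[R]_n) := (u^T *m K *m u) 0 0.
have phiV := phi_basis.1.
have A_ge0 u : 0 <= form _ A u by exact: stiffness1_form_ge0.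
have Amg_lower u : u != 0 -> delta <= form _ A u / form _ Amg u.
  by move=> /Amg_equiv/andP[].
have Amg_posdef : sym_posdef Amg.
  by split=> // u; exact: (spectral_equiv_gt0 A_ge0 delta_gt0 Amg_lower).
have calAmg_posdef : sym_posdef calAmg by exact: tens1_sym_posdef.
have Dp_posdef : sym_posdef Dp.
  split; first by rewrite tr_diag_mx.
  move=> q q0; rewrite mxE.
  have [i qi0] : exists i, q i 0 != 0.
    apply/existsP; rewrite -negb_forall; apply: contra q0 => /forallP q0.
    by apply/eqP/matrixP => i j; rewrite ord1 mxE; exact/eqP.
  have sqE j : (q^T *m Dp) 0 j * q j 0 = Mp j j * q j 0 ^+ 2.
    by rewrite mul_mx_diag !mxE; ring.
  rewrite (bigD1 i)//= ltr_pwDl//.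
    by rewrite sqE mulr_gt0 ?mass_mx_diag_gt0// exprn_even_gt0.
  rewrite sumr_ge0// => j _.
  by rewrite sqE mulr_ge0 ?sqr_ge0// ltW// mass_mx_diag_gt0.
have calSp_posdef : sym_posdef calSp by exact: tens1_sym_posdef.
have c_gt0 : 0 < nu0_inf - sqrt3 * sigma * chi by rewrite subr_gt0.
have a_gt0 : 0 < a by rewrite !mulr_gt0.
(* [galerkin_form_le] with the coordinate [y_m] as weight: [sqrt3] bounds it on the cube, and
   [sigma] times the norm [chi_ m] bounds the form of [A_ m] by that of [A]. *)
have Gm_form m v : `|form _ (G m *t A_ m) v| <=
    sqrt3 * (sigma * fine (chi_ m)) * form _ ((1%:M : 'M[R]_Q) *t A) v.
  have bnu := Linfty_ess_bounded (nu_Linfty m).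
  apply: galerkin_form_le.
  - apply: le_lt_trans (probability_le1 (uniform_cube M) measurableT) _.
    by rewrite ltry.
  - by move=> i; exact: legendre_prod_ess_bounded.
  - exact: legendre_prod_orthonormal p_legendre alpha_enum.1.
  - exact: tnth_ess_bounded.
  - by apply: ae_mono (@ae_cube R M) => y ys _; exact: ys.
  move=> u; apply: stiffness_form_norm_le => //.
    rewrite (_ : (fun x => _) = fun x => sigma * (Num.sqrt (lam m) * nu m x)).
      by apply: ess_boundedM bnu; exact: ess_bounded_cst.
    by apply/funext => x; rewrite mulrA.
  apply: ae_mono (Linfty_ae (nu_Linfty m)) => x bx /bx {}bx.
  by rewrite -mulrA normrM (gtr0_norm sigma_gt0) ler_pM2l.
have A0_form v : nu0_inf * form _ ((1%:M : 'M[R]_Q) *t A) v <=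
    form _ ((1%:M : 'M[R]_Q) *t A0) v.
  rewrite /form !tens1_form mulr_sumr; apply: ler_sum => i _.
  apply: stiffness_form_ge => //; first exact: Linfty_ess_bounded.
  exact: ess_inf_on_ae.
have calA_form v : (nu0_inf - sqrt3 * sigma * chi) *
    form _ ((1%:M : 'M[R]_Q) *t A) v <= form _ calA v.
  have tA_ge0 : 0 <= form _ ((1%:M : 'M[R]_Q) *t A) v.
    by rewrite /form tens1_form sumr_ge0// => i _; exact: A_ge0.
  have -> : form _ calA v = form _ ((1%:M : 'M[R]_Q) *t A0) v +
      \sum_(m < M) form _ (G m *t A_ m) v.
    by rewrite /form /calA mulmxDr mulmxDl mxE mulmx_sumr mulmx_suml summxE.
  rewrite mulrBl; apply: lerD; first exact: A0_form.
  (* Each stochastic term is allowed its worst sign; the bounds then add up to a partial sum of the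
     series [chi], for any [M]. *)
  apply: (@le_trans _ _ (- \sum_(m < M) `|form _ (G m *t A_ m) v|)).
    rewrite lerN2; apply: (@le_trans _ _ (\sum_(m < M)
      sqrt3 * (sigma * fine (chi_ m)) * form _ ((1%:M : 'M[R]_Q) *t A) v)).
      exact: ler_sum.
    rewrite -mulr_suml ler_wpM2r// -mulr_sumr -mulrA.
    rewrite ler_wpM2l ?sqrtr_ge0// -mulr_sumr ler_wpM2l ?(ltW sigma_gt0)//.
    exact: sum_Linfty_norm_le.
  rewrite lerNl -sumrN; apply: ler_sum => m _.
  by rewrite -normrN ler_norm.
have tA_form v : delta * form _ calAmg v <= form _ ((1%:M : 'M[R]_Q) *t A) v.
  rewrite /form !tens1_form mulr_sumr; apply: ler_sum => i _.
  exact: (spectral_equiv_le A_ge0 delta_gt0 Amg_lower).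
have calA_posdef : sym_posdef (calA - a *: calAmg).
  split.
    rewrite linearB linearZ /= calAmg_posdef.1; congr (_ - _).
    rewrite /calA linearD /= trmx_tens trmx1 stiffness_sym//; congr (_ + _).
    rewrite raddf_sum; apply: eq_bigr => m _.
    rewrite /= trmx_tens stiffness_sym//; congr (_ *t _).
    apply/matrixP => i j; rewrite !mxE; apply: eq_Rintegral => y _.
    by rewrite mulrAC.
  move=> v v0; rewrite mulmxBr mulmxBl mxE [X in _ + X]mxE subr_gt0.
  rewrite -scalemxAr -scalemxAl mxE -/(form _ calAmg v) -/(form _ calA v).
  have Kv : 0 < form _ calAmg v by exact: calAmg_posdef.2.
  (* With [c] the coercivity constant, the form of [calA] is at least that of [c (I (x) A)], hence
     of [c delta calAmg]; this strictly exceeds that of [a *: calAmg] because [a_delta < 1]. *)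
  apply: lt_le_trans (calA_form v).
  apply: (@lt_le_trans _ _ ((nu0_inf - sqrt3 * sigma * chi) *
    (delta * form _ calAmg v))); last by rewrite ler_pM2l.
  by rewrite mulrA ltr_pM2r// /a gtr_pMl// mulr_gt0.
have aAmg_posdef := sym_posdefZ a_gt0 calAmg_posdef.
split; first exact: sym_posdef_block.
split; first exact: block_triangular_unitmx.
split; first exact: preconditioned_saddle_sym.
move=> v q w w0 q_mean; apply: preconditioned_saddle_pos => // Bq.
(* Both conditions on [q] involve matrices of the form [I (x) N], so they hold block by block, and
   inf-sup stability applies to each block. *)
apply: tens_block_eq0 => i; apply: (infsup_ker_eq0 vphi_nodal phi_basis) => //.
- rewrite -/B -(tens_block_mul1 B^T) -[1%:M]trmx1 -trmx_tens Bq.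
  by apply/matrixP => ? ?; rewrite !mxE.
- by rewrite -(tens_block_mul1 _ q) q_mean; apply/matrixP => ? ?; rewrite !mxE.
Qed.
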